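(* There are absolute constants $C>0$ and $c_{\mathrm{bdg}}>0$ such that the following holds. Assume $\mathcal I=\emptyset$ (no random constraints, so $X=\widehat X=Y$). Let $Y$ be convex and closed, $f$ continuous and convex, and $x\mapsto F_0(x,\xi)$ convex for all $\xi\in\Xi$. Suppose there are $\mathfrak c>0$, $\kappa\in(0,1]$, $\vartheta_*>0$ such that $\mathrm{diam}(X^{*,\epsilon})\le\mathfrak c\,\epsilon^\kappa+\mathrm{diam}(X^* )$ for all $\epsilon\in(0,\vartheta_*]$. Assume $(\sigma_*^2,\sigma^2,\alpha,\rho)$-goodness over $Z=X^{*,\vartheta_*}$. Let $t>0$ and $\epsilon_0\in[0,\vartheta_*/2)$. Define $\phi_N(t):=\sqrt{(\mathfrak C_\alpha+t)/N}$ and suppose $N$ is large enough that $$\epsilon_0+2C\sigma\big(\mathfrak c^\alpha\vartheta_*^{\kappa\alpha}+\mathrm{diam}^\alpha(X^* )\big)\phi_N(t)\le\vartheta_*/2.$$ Define $$\mathfrak R_N:=\begin{cases}2\epsilon_0+4C\sigma\,\mathrm{diam}^\alpha(X^* )\,\phi_N(t),&\alpha\kappa=1,\\[2pt] \max\Big\{2\epsilon_0+4C\sigma\,\mathrm{diam}^\alpha(X^* )\,\phi_N(t),\ \big[4C\mathfrak c^\alpha\sigma\phi_N(t)\big]^{\frac1{1-\alpha\kappa}}\Big\},&\alpha\kappa\in(0,1).\end{cases}$$ Let $\mathrm{Good}(t,\epsilon_0)$ be the event where both of the following hold: (a) $\widehat X^{*,\epsilon_0}\subset X^{*,\mathfrak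 R_N}$, i.e. all $x\in\widehat X$ with $\widehat F(x)\le\widehat F^*+\epsilon_0$ satisfy $f(x)\le f^*+\mathfrak R_N$ and $x\in X$; (b) $|\widehat F^*-f^*|\le\sigma_*\sqrt{\dfrac{6(1+\log2+t)}{N}}+\dfrac32\,\mathfrak R_N$. Then $\mathbb P(\mathrm{Good}(t,\epsilon_0))\ge1-e^{-t}-2\rho$. If one assumes $(\sigma_*^2,\sigma^2,\alpha,p,\kappa_p)$-greatness instead of $(\sigma_*^2,\sigma^2,\alpha,\rho)$-goodness (over the same set), one may take $\rho=(c_{\mathrm{bdg}}\,\kappa_p\sqrt{p/N})^p$.
   Context: Setting. $\|\cdot\|$ is a norm on $\mathbb R^d$, and $\mathrm{diam}$ is taken in this norm. $(\Xi,\sigma(\Xi),\mathbf P)$ is a probability space and $\xi_1,\dots,\xi_N$ are i.i.d. with law $\mathbf P$, defined on $(\Omega,\mathcal A,\mathbb P)$. For a function $H$ on $\Xi$, $\mathbf E H=\int H\,d\mathbf P$ and $\widehat{\mathbf E}H=\frac1N\sum_{k=1}^N H(\xi_k)$. In general the problem has an objective indexed by $0$ and constraints indexed by a finite set $\mathcal I$; here $\mathcal I=\emptyset$. $Y\subset\mathbb R^d$ is nonempty, $F_0:Y\times\Xi\to\mathbb R$ is Carathéodory (measurable in $\xi$, continuous in $x$) with $\mathbf E|F_0(x,\cdot)|<\infty$; $f(x)=f_0(x):=\mathbf E F_0(x,\cdot)$, $\widehat F(x):=\widehat{\mathbf E}F_0(x,\cdot)$. The ideal problem is $f^*:=\min_{x\in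 X}f(x)$ with $X=Y$, the minimum assumed attained, and $x^*$ is a fixed minimizer; the sample average approximation (SAA) is $\widehat F^*:=\min_{x\in\widehat X}\widehat F(x)$ with $\widehat X=Y$, also assumed always to have a solution. $X^{*,\vartheta}:=\{x\in X:f(x)\le f^*+\vartheta\}$, $X^*:=X^{*,0}$, $\widehat X^{*,\vartheta}:=\{x\in\widehat X:\widehat F(x)\le\widehat F^*+\vartheta\}$. $h:\Xi\to\mathbb R_+$ is $(\sigma^2,\rho)$-good if $\mathbf E h\le\sigma^2$ and $\mathbb P\{\widehat{\mathbf E}h>2\sigma^2\}\le\rho$; for $p\ge2$ it is $(\sigma^2,p,\kappa_p)$-great if $\mathbf E h\le\sigma^2$ and $\|h(\xi)-\mathbf E h\|_{L^p}\le\kappa_p\sigma^2$ for $\xi\sim\mathbf P$. $(\sigma_*^2,\sigma^2,\alpha,\rho)$-goodness over $Z\subset Y$ with $x^*\in Z$ (where $\sigma^2,\sigma_*^2,\rho>0$, $\alpha\in(0,1]$) means (here, with $\mathcal I=\emptyset$): $f$ and $F_0(\cdot,\xi)$ are continuous on $Y$; $\xi\mapsto(F_0(x^*,\xi)-f(x^* ))^2$ is $(\sigma_*^2,\rho)$-good; and there is $\mathsf L_0:\Xi\to\mathbb R$ with $\mathsf L_0^2$ $(\sigma^2,\rho)$-good and $|F_0(x,\xi)-F_0(x',\xi)|\le\mathsf L_0(\xi)\|x-x'\|^\alpha$ for all $x,x'\in Z$, $\xi\in\Xi$. $(\sigma_*^2,\sigma^2,\alpha,p,\kappa_p)$-greatness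 over $Z$ (with $p\ge2$, $\kappa_p\ge1$) is the same with ''$(\sigma_*^2,\rho)$-good'', ''$(\sigma^2,\rho)$-good'' replaced by ''$(\sigma_*^2,p,\kappa_p)$-great'', ''$(\sigma^2,p,\kappa_p)$-great''. Generic chaining functional: for a metric space $\mathcal M$, a sequence $\{\mathcal A_j\}_{j\ge0}$ of partitions is admissible if $|\mathcal A_0|=1$, $|\mathcal A_j|\le2^{2^j}$ for $j\ge1$; $\mathrm{diam}(\mathcal A_j)$ is the largest diameter of a cell; $\gamma_2^{(\alpha)}(\mathcal M):=\inf_{\text{admissible}}\sum_{j\ge0}2^{j/2}\mathrm{diam}(\mathcal A_j)^\alpha$ (metric from $\|\cdot\|$). Finally $$\mathfrak C_\alpha:=\sup_{\epsilon\in[0,\vartheta_*]}\left(\frac{\gamma_2^{(\alpha)}(X^{*,\epsilon})}{\mathrm{diam}^\alpha(X^{*,\epsilon})}\right)^2,$$ with the convention that the ratio is $1$ when $X^{*,\epsilon}$ is a single point. *)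

(* Defs.v *)
From HB Require Import structures.
From mathcomp Require Import all_boot all_order all_algebra.
From mathcomp Require Import all_classical all_reals all_analysis.

Set Implicit Arguments.
Unset Strict Implicit.
Unset Printing Implicit Defensive.
Import Order.TTheory GRing.Theory Num.Theory.
Import numFieldNormedType.Exports.

Local Open Scope classical_set_scope.
Local Open Scope card_scope.
Local Open Scope ring_scope.

(* An arbitrary norm on R^d.  Topological notions on ['rV[R]_d] (closedness,
   continuity) refer to the library's product topology, which is the topology
   of every norm. *)
Definition is_norm (R : realType) (d : nat) (nrm : 'rV[R]_d -> R) : Prop :=
  [/\ forall x, nrm x = 0 -> x = 0,
      forall a x, nrm (a *: x) = `|a| * nrm x
    & forall x y, nrm (x + y) <= nrm x + nrm y].

(* Diameters take values in [\bar R], so that an unbounded set has diameter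
   [+oo]. *)
Definition diam (R : realType) (d : nat) (nrm : 'rV[R]_d -> R)
    (M : set 'rV[R]_d) : \bar R :=
  ereal_sup [set (nrm (x - y))%:E | x in M & y in M].

Section generic_chaining.
Variables (R : realType) (d : nat) (nrm : 'rV[R]_d -> R).
Implicit Types (M : set 'rV[R]_d) (A : nat -> set (set 'rV[R]_d)).

(* The partitions are not required to be nested. *)
Definition admissible M A : Prop :=
  [/\ forall j, partition (A j) id M,
      A 0%N #= `I_1
    & forall j, (1 <= j)%N -> A j #<= `I_(2 ^ (2 ^ j))].

Definition diam_partition (P : set (set 'rV[R]_d)) : \bar R :=
  ereal_sup [set diam nrm B | B in P].

Definition gamma2 (alpha : R) M : \bar R :=
  ereal_inf [set (\sum_(0 <= j <oo)
      (2 `^ (j%:R / 2))%:E * diam_partition (A j) `^ alpha)%E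
    | A in admissible M].

(* On singletons the quotient would be 0 / 0; it is set to 1 by convention. *)
Definition chaining_ratio (alpha : R) M : \bar R :=
  if `[< exists x, M = [set x] >] then 1%E
  else (gamma2 alpha M / diam nrm M `^ alpha)%E.

End generic_chaining.

Section optimization.
Variables (R : realType) (d : nat).
Implicit Types (Y : set 'rV[R]_d) (g : 'rV[R]_d -> R).

Definition minimizer Y g (x : 'rV[R]_d) : Prop :=
  Y x /\ forall y, Y y -> g x <= g y.

(* Used only when the minimum of [g] over [Y] is attained; [inf] is then that
   minimum. *)
Definition opt_value Y g : R := inf [set g x | x in Y].

(* The tolerance is extended real because it is instantiated below with
   quantities built from diameters. *)
Definition near_opt Y g (theta : \bar R) : set 'rV[R]_d :=
  [set x | Y x /\ ((g x)%:E <= (opt_value Y g)%:E + theta)%E].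

End optimization.

Definition chaining_const (R : realType) (d : nat) (nrm : 'rV[R]_d -> R)
    (Y : set 'rV[R]_d) (f : 'rV[R]_d -> R) (alpha vartheta : R) : \bar R :=
  ereal_sup [set ((chaining_ratio nrm alpha (near_opt Y f eps%:E)) ^+ 2)%E
    | eps in `[0, vartheta]].

Definition iid_sample (R : realType) (dX dO : measure_display)
    (Xi : measurableType dX) (Omega : measurableType dO)
    (PX : probability Xi R) (PO : probability Omega R) (N : nat)
    (xi : 'I_N -> {RV PO >-> Xi}) : Prop :=
  (forall k A, measurable A -> distribution PO (xi k) A = PX A) /\
  (forall (J : {set 'I_N}) (A : 'I_N -> set Xi),
      (forall k, measurable (A k)) ->
      PO [set w | forall k, k \in J -> A k (xi k w)] =
      (\prod_(k in J) PO (xi k @^-1` A k))%E).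

Definition emp_mean (R : realType) (Xi Omega : Type) (N : nat)
    (xi : 'I_N -> Omega -> Xi) (H : Xi -> R) (w : Omega) : R :=
  (\sum_(k < N) H (xi k w)) / N%:R.

Section good_and_great.
Variables (R : realType) (dX dO : measure_display).
Variables (Xi : measurableType dX) (Omega : measurableType dO).
Variables (PX : probability Xi R) (PO : probability Omega R).
Variables (N : nat) (xi : 'I_N -> {RV PO >-> Xi}).

Definition good_fun (rho s2 : R) (h : Xi -> R) : Prop :=
  [/\ measurable_fun setT h, forall z, 0 <= h z,
      ('E_PX[h] <= s2%:E)%E
    & (PO [set w | (2 * s2 < emp_mean xi h w)%R] <= rho%:E)%E].

Definition great_fun (p kp s2 : R) (h : Xi -> R) : Prop :=
  [/\ measurable_fun setT h, forall z, 0 <= h z,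
      ('E_PX[h] <= s2%:E)%E
    & ('N[PX]_(p%:E)[ (fun z => (h z)%:E - 'E_PX[h]) ] <= (kp * s2)%:E)%E].

Definition mean_obj (d : nat) (F : 'rV[R]_d -> Xi -> R) (x : 'rV[R]_d) : R :=
  \int[PX]_z F x z.

(* The part shared by goodness and greatness: [Q s2 h] stands for "[h] is
   good/great with second-moment parameter [s2]". *)
Definition hoelder_regular (d : nat) (nrm : 'rV[R]_d -> R)
    (Y : set 'rV[R]_d) (F : 'rV[R]_d -> Xi -> R) (xstar : 'rV[R]_d)
    (Q : R -> (Xi -> R) -> Prop) (ss2 s2 alpha : R)
    (Z : set 'rV[R]_d) : Prop :=
  [/\ [/\ 0 < ss2, 0 < s2, 0 < alpha & alpha <= 1],
      Z `<=` Y /\ Z xstar,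
      {within Y, continuous (mean_obj F)} /\
        (forall z, {within Y, continuous (F ^~ z)}),
      Q ss2 (fun z => (F xstar z - mean_obj F xstar) ^+ 2)
    & exists L0 : Xi -> R,
        Q s2 (fun z => L0 z ^+ 2) /\
        forall x x' z, Z x -> Z x' ->
          `|F x z - F x' z| <= L0 z * nrm (x - x') `^ alpha].

Definition goodness_over (d : nat) (nrm : 'rV[R]_d -> R)
    (Y : set 'rV[R]_d) (F : 'rV[R]_d -> Xi -> R) (xstar : 'rV[R]_d)
    (ss2 s2 alpha rho : R) (Z : set 'rV[R]_d) : Prop :=
  0 < rho /\
  hoelder_regular nrm Y F xstar (good_fun rho) ss2 s2 alpha Z.

Definition greatness_over (d : nat) (nrm : 'rV[R]_d -> R)
    (Y : set 'rV[R]_d) (F : 'rV[R]_d -> Xi -> R) (xstar : 'rV[R]_d)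
    (ss2 s2 alpha p kp : R) (Z : set 'rV[R]_d) : Prop :=
  [/\ 2 <= p, 1 <= kp
    & hoelder_regular nrm Y F xstar (great_fun p kp) ss2 s2 alpha Z].

Definition saa_obj (d : nat) (F : 'rV[R]_d -> Xi -> R) (w : Omega)
    (x : 'rV[R]_d) : R :=
  emp_mean xi (F x) w.

Definition good_event (d : nat) (Y : set 'rV[R]_d)
    (F : 'rV[R]_d -> Xi -> R) (sigmas t eps0 : R) (RN : \bar R) : set Omega :=
  [set w |
    near_opt Y (saa_obj F w) eps0%:E `<=` near_opt Y (mean_obj F) RN /\
    (`|opt_value Y (saa_obj F w) - opt_value Y (mean_obj F)|%:E <=
      (sigmas * Num.sqrt (6 * (1 + ln 2 + t) / N%:R))%:E
        + (3 / 2)%:E * RN)%E].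

End good_and_great.

Definition phi_rate (R : realType) (Calpha : \bar R) (N : nat) (t : R)
    : \bar R :=
  sqrte ((Calpha + t%:E) * (N%:R^-1)%:E)%E.

(* [D] is the diameter of the solution set and [phi] the value of
   [phi_rate]. *)
Definition opt_rate (R : realType) (C eps0 sigma c alpha kappa : R)
    (D phi : \bar R) : \bar R :=
  let base := ((2 * eps0)%:E + (4 * C * sigma)%:E * D `^ alpha * phi)%E in
  if alpha * kappa == 1 then base
  else maxe base
    (((4 * C * c `^ alpha * sigma)%:E * phi) `^ (1 / (1 - alpha * kappa)))%E.

(* Main.v *)
(* The sample fluctuations enter through two elementary bounds.  Since
   [exp (x - x^2/6) <= 1 + x + x^2/3], a centred [X] with [E X^2 <= v] has
   [E exp (l X - l^2 X^2 / 6) <= exp (l^2 v / 3)], so that the sums of i.i.d.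
   copies of [X] have subgaussian tails on the event that the empirical second
   moment is small, without symmetrization.  On that event the increments
   [(F^ - f) x - (F^ - f) y] are subgaussian at scale
   [sigma |x - y|^alpha / sqrt N], and generic chaining over [X^{*,eps}],
   started at the dyadic level of size [t], bounds the fluctuation there by
   [100 sigma diam^alpha phi_N(t)], which is less than [eps - eps0] for every
   [eps > 0] in [[R_N, vartheta]].  If an [eps0]-solution of the SAA had
   [f > f* + eps], convexity and the intermediate value theorem would give a
   point of the segment to [x*] with [f = f* + eps], contradicting that bound.
   Letting [eps] decrease to [R_N] also covers [R_N = 0].

   Greatness implies goodness by a Fuk-Nagaev argument: [X] is truncated at
   [N s2 / p], which gives the moment order of the Burkholder inequality for
   the upper tail without an actual moment inequality. *)


Require Import Defs.
From HB Require Import structures.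
From mathcomp Require Import all_boot all_order all_algebra.
From mathcomp Require Import all_classical all_reals all_analysis.
From mathcomp Require Import measurable_realfun ring lra zify.

Set Implicit Arguments.
Unset Strict Implicit.
Unset Printing Implicit Defensive.
Import Order.TTheory GRing.Theory Num.Theory.
Import numFieldNormedType.Exports.

Local Open Scope classical_set_scope.
Local Open Scope ring_scope.

(** * Exponential inequalities for i.i.d. samples *)

(** Chaining is done relative to [xstar]. The deviation at [xstar] itself affects only the estimate
    of the optimal value, which is why [sigmas] occurs in that estimate and not in the rate.
    Localization needs the relative deviation at one fixed level [eps], so no union over levels is
    taken. The bound it requires is strict, and the large-sample condition provides this by carrying
    [2 * C] where chaining costs only [C].

    The failure probability splits into one [rho] for each of the two empirical second moments, at
    most half of [expR (- t)] for the deviation at [xstar], and a quarter of it for the chaining.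

    The good event quantifies over an uncountable and possibly unbounded [Y], so its measurability
    is a separate argument through compact pieces of [Y]. Chaining meets only countably many net
    points: the Hoelder bound of each outcome controls what is left after finitely many links. *)

Section exp_inequalities.
Variable R : realType.
Implicit Types x y B : R.

Lemma expR_sub_sqr_le x : expR (x - x ^+ 2 / 6) <= 1 + x + x ^+ 2 / 3.
Proof.
(* The quotient of the two sides. With the coefficients 1/6 and 1/3 the lower-order terms of its
   derivative cancel, leaving [y ^+ 3 / 9] times an exponential; so [h] is least at 0, where it
   equals 1. *)
pose h y : R := (1 + y + y ^+ 2 / 3) * expR (- y + y ^+ 2 / 6).
have dh y : is_derive y 1 h (y ^+ 3 / 9 * expR (- y + y ^+ 2 / 6)).
  rewrite /h; apply: is_derive_eq.
  by rewrite /GRing.scale/= ?mulr1 ?add0r; field.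
have h1 : 1 <= h x.
  have h0 : h 0 = 1 by rewrite /h expr0n/= oppr0 !mul0r !addr0 expR0 mulr1.
  have ch (A : set R) : {within A, continuous h}.
    apply: continuous_subspaceT => z.
    by apply/differentiable_continuous/derivable1_diffP; case: (dh z).
  have [x0|x0] := leP 0 x.
    rewrite -h0; apply: (@ger0_derive1_ndecry _ h 0) => //.
    move=> z; rewrite in_itv/= andbT => z0; rewrite derive1E (@derive_val _ _ _ _ _ _ _ (dh z)).
    by rewrite mulr_ge0 ?expR_ge0// divr_ge0// exprn_ge0// ltW.
  rewrite -h0; apply: (@ler0_derive1_nincrNy _ h 0) => //; last exact: ltW.
  move=> z; rewrite in_itv/= => z0; rewrite derive1E (@derive_val _ _ _ _ _ _ _ (dh z)).
  rewrite mulr_le0_ge0 ?expR_ge0// mulr_le0_ge0// exprSr mulr_ge0_le0 ?sqr_ge0//.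
  exact: ltW.
have -> : x - x ^+ 2 / 6 = - (- x + x ^+ 2 / 6) by ring.
by rewrite expRN -[leLHS]mul1r ler_pdivrMr ?expR_gt0.
Qed.

(** Suited to a variable bounded only from above, which is what one-sided truncation produces: the
    factor [expR B] multiplies the second moment alone. *)
Lemma expR_le_quad x B : x <= B -> 0 <= B ->
  expR x <= 1 + x + x ^+ 2 * expR B.
Proof.
move=> xB B0.
have e1 : expR x - 1 <= x * expR x.
  have := expR_ge1Dx (- x); rewrite expRN => /(ler_wpM2r (ltW (expR_gt0 x))).
  rewrite mulVf ?gt_eqF ?expR_gt0//; lra.
have [x0|x0] := leP 0 x.
  have : x * (expR x - 1) <= x ^+ 2 * expR B.
    rewrite expr2 -mulrA ler_wpM2l// (le_trans e1)// ler_wpM2l//.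
    by rewrite ler_expR.
  lra.
have : 1 <= expR B by rewrite -expR0 ler_expR.
have := expR_ge1Dx x; have := expR_gt0 x; nra.
Qed.

End exp_inequalities.

Section measurable_comparison.
Context d (T : measurableType d) (R : realType).
Implicit Types f g : T -> R.

Lemma measurable_lt f g : measurable_fun setT f -> measurable_fun setT g ->
  measurable [set w | f w < g w].
Proof.
move=> mf mg; have := measurable_fun_ltr mf mg measurableT (Y := [set true]) I.
by rewrite setTI.
Qed.

Lemma measurable_le f g : measurable_fun setT f -> measurable_fun setT g ->
  measurable [set w | f w <= g w].
Proof.
move=> mf mg; have := measurable_fun_ler mf mg measurableT (Y := [set true]) I.
by rewrite setTI.
Qed.

End measurable_comparison.

Lemma finite_union_bound d (T : measurableType d) (R : realType)
    (mu : {measure set T -> \bar R}) (I : finType) (A : I -> set T) :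
  (forall i, measurable (A i)) ->
  (mu (\big[setU/set0]_i A i) <= \sum_i mu (A i))%E.
Proof.
move=> mA; suff [] : measurable (\big[setU/set0]_i A i) /\
    (mu (\big[setU/set0]_i A i) <= \sum_i mu (A i))%E by [].
elim/big_rec2 : _ => [|i y S _ [mS Sy]]; first by rewrite measure0.
split; first exact: measurableU.
by rewrite (le_trans (measureU2 _ _ _))// leeD2l.
Qed.

Section product_expectation.
Context d d' (T : measurableType d) (T' : measurableType d') (R : realType).
Variables (mu : {measure set T -> \bar R}) (nu : {measure set T' -> \bar R}).
Import HBNNSimple.
Local Open Scope ereal_scope.

(** Extends a factorization from indicators to nonnegative functions, through simple functions and
    monotone convergence. In use, [G] is the product over the other sample points and [C] the
    product of their integrals, so independence is exploited one factor at a time, without a product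
    measure. *)
Lemma ge0_integral_weighted (G : T -> R) (X : T -> T') (C : \bar R) :
  measurable_fun setT G -> (forall w, (0 <= G w)%R) ->
  measurable_fun setT X -> C \is a fin_num ->
  (forall B, measurable B ->
    \int[mu]_w (G w * \1_B (X w))%:E = C * nu B) ->
  forall g : T' -> R, measurable_fun setT g -> (forall z, (0 <= g z)%R) ->
    \int[mu]_w (G w * g (X w))%:E = C * \int[nu]_z (g z)%:E.
Proof.
move=> mG G0 mX C0 GB g mg g0.
have simple (s : {nnsfun T' >-> R}) :
    \int[mu]_w (G w * s (X w))%:E = C * \int[nu]_z (s z)%:E.
  under eq_integral => w _ do rewrite fimfunEord mulr_sumr -sumEFin.
  under [in RHS]eq_integral => w _ do rewrite fimfunEord -sumEFin.
  set e := finmap.enum_fset _.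
  have s0 i : (0 <= e`_i)%R.
    have [ilt|?] := ltnP i (size e); last by rewrite nth_default.
    have := mem_nth 0%R ilt; rewrite in_fset_set// inE => -[z _ <-].
    exact: fun_ge0.
  rewrite ge0_integral_sum//=; last 2 first.
  - move=> i; apply/measurable_EFinP; apply: measurable_funM => //.
    apply: measurable_funM => //; apply: (measurableT_comp _ mX).
    exact: measurable_indic.
  - by move=> i w _; rewrite lee_fin !mulr_ge0// s0.
  rewrite ge0_integral_sum//=; last 2 first.
  - move=> i; apply/measurable_EFinP; apply: measurable_funM => //.
  - by move=> i w _; rewrite lee_fin !mulr_ge0// s0.
  rewrite ge0_sume_distrr; last first.
    by move=> i _; apply: integral_ge0 => z _; rewrite lee_fin mulr_ge0// s0.
  apply: eq_bigr => i _.
  under eq_integral => w _ do rewrite mulrCA EFinM.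
  under [in RHS]eq_integral => w _ do rewrite EFinM.
  have mI : measurable_fun setT (fun w => (G w * \1_(s @^-1` [set e`_i]) (X w))%:E).
    apply/measurable_EFinP; apply: measurable_funM => //.
    by apply: (measurableT_comp _ mX); exact: measurable_indic.
  have ei : 0 <= (e`_i)%:E by rewrite lee_fin.
  rewrite ge0_integralZl//; last by move=> w _; rewrite lee_fin mulr_ge0.
  rewrite ge0_integralZl//; last exact/measurable_EFinP.
  by rewrite GB// integral_indic// setIT muleCA.
have mEg : measurable_fun setT (EFin \o g) by exact/measurable_EFinP.
pose u := nnsfun_approx measurableT mEg.
have u_cvg z : (u n z)%:E @[n --> \oo] --> (g z)%:E.
  by apply: (@cvg_nnsfun_approx _ _ _ _ _ _ mEg) => // y _; rewrite lee_fin.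
have u_nd z : {homo (fun n => u n z) : m n / (m <= n)%N >-> (m <= n)%R}.
  move=> m n mn; have := @nd_nnsfun_approx _ _ _ _ measurableT _ mEg _ _ mn.
  by move=> /asboolP; exact.
have lhs : \int[mu]_w (G w * u n (X w))%:E @[n --> \oo] -->
    \int[mu]_w (G w * g (X w))%:E.
  rewrite [X in _ --> X](_ : _ =
      \int[mu]_w limn (fun n => (G w * u n (X w))%:E)); last first.
    apply: eq_integral => w _; apply/esym/cvg_lim => //.
    under eq_fun do rewrite EFinM.
    by rewrite EFinM; apply: cvgeZl.
  apply: cvg_monotone_convergence => //.
  - move=> n; apply/measurable_EFinP; apply: measurable_funM => //.
    by apply: (measurableT_comp _ mX); exact: measurable_funP.
  - by move=> n w _; rewrite lee_fin mulr_ge0.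
  - by move=> w _ m n mn; rewrite lee_fin ler_wpM2l// u_nd.
have rhs : \int[nu]_z (u n z)%:E @[n --> \oo] --> \int[nu]_z (g z)%:E.
  rewrite [X in _ --> X](_ : _ = \int[nu]_z limn (fun n => (u n z)%:E)); last first.
    by apply: eq_integral => w _; apply/esym/cvg_lim.
  apply: cvg_monotone_convergence => //.
  - by move=> n; apply/measurable_EFinP; exact: measurable_funP.
  - by move=> n w _; rewrite lee_fin.
  - by move=> w _ m n mn; rewrite lee_fin u_nd.
apply: (cvg_unique _ lhs) => //=.
under eq_fun do rewrite simple.
exact: cvgeZl.
Qed.
End product_expectation.

Section iid.
Context (R : realType) (dX dO : measure_display).
Context (Xi : measurableType dX) (Omega : measurableType dO).
Variables (PX : probability Xi R) (PO : probability Omega R).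
Variables (N : nat) (xi : 'I_N -> {RV PO >-> Xi}).
Hypothesis iid : iid_sample PX xi.
Local Open Scope ereal_scope.

(** Induction on the number [m] of factors that are already functions, the others being indicators
    of arbitrary sets. The case [m = 0] is independence itself; in the step, the set at index [m] is
    varied and [ge0_integral_weighted] replaces its indicator by [h]. *)
Lemma expectation_prod (h : 'I_N -> Xi -> R) :
  (forall k, measurable_fun setT (h k)) -> (forall k z, (0 <= h k z)%R) ->
  (forall k, \int[PX]_z (h k z)%:E < +oo) ->
  \int[PO]_w (\prod_k h k (xi k w))%:E = \prod_k \int[PX]_z (h k z)%:E.
Proof.
move=> mh h0 hoo.
pose H m (A : 'I_N -> set Xi) (k : 'I_N) : Xi -> R := if (k < m)%N then h k else \1_(A k).
have mH m A k : (forall j, measurable (A j)) -> measurable_fun setT (H m A k).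
  by move=> mA; rewrite /H; case: ifP => // _; exact: measurable_indic.
have H0 m A k z : (0 <= H m A k z)%R by rewrite /H; case: ifP.
suff key m : (m <= N)%N -> forall A, (forall k, measurable (A k)) ->
    \int[PO]_w (\prod_k H m A k (xi k w))%:E = \prod_k \int[PX]_z (H m A k z)%:E.
  have := key N (leqnn _) (fun=> setT) (fun=> measurableT).
  by under eq_integral do under eq_bigr do rewrite /H ltn_ord;
    under [in RHS]eq_bigr do rewrite /H ltn_ord.
elim: m => [_ A mA|m IH mN A mA].
  have [distr prod] := iid.
  have mS : measurable (\bigcap_(k in [set: 'I_N]) (xi k @^-1` A k)).
    apply: fin_bigcap_measurable => // k _; rewrite -[X in measurable X]setTI.
    exact: (measurable_funP (xi k)).
  transitivity (PO [set w | forall k, k \in [set: 'I_N]%SET -> A k (xi k w)]).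
    rewrite [X in PO X](_ : _ = \bigcap_(k in [set: 'I_N]) (xi k @^-1` A k)); last first.
      apply/seteqP; split=> w /= Aw k => [_|_]; last exact: Aw.
      by apply: Aw; rewrite inE.
    rewrite -[X in PO X](setIT _) -integral_indic//; apply: eq_integral => w _.
    congr EFin; rewrite indicE; have [Sw|nSw] := boolP (w \in _).
      by apply: big1 => k _; rewrite /H/= indicE mem_set//; move: Sw; rewrite inE; apply.
    have [k nAk] : exists k, ~ A k (xi k w).
      apply/existsNP => Aw; move/negP : nSw; apply; rewrite inE => k _; exact: Aw.
    by rewrite (bigD1 k)//= /H/= indicE memNset// mul0r.
  rewrite prod//; apply: eq_big => [k|k _]; first by rewrite inE.
  have := distr k _ (mA k); rewrite /distribution/= /pushforward => ->.
  by rewrite /H/= integral_indic// setIT.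
pose k0 := Ordinal mN.
have mX k : measurable_fun setT (xi k) by exact: measurable_funP.
pose G w := (\prod_(k | k != k0) H m A k (xi k w))%R.
pose C := \prod_(k | k != k0) \int[PX]_z (H m A k z)%:E.
have Hm1 k : k != k0 -> H m.+1 A k = H m A k.
  rewrite /H ltnS leq_eqVlt => kk0; case: (@eqP _ (val k) m) => // km.
  by move: kk0; rewrite -val_eqE/= km eqxx.
transitivity (\int[PO]_w (G w * h k0 (xi k0 w))%:E).
  apply: eq_integral => w _; rewrite (bigD1 k0)//= mulrC /H/= ltnSn -/(H _ _).
  by congr (_ * _)%:E; apply: eq_bigr => k kk0; rewrite -Hm1.
transitivity (C * \int[PX]_z (h k0 z)%:E); last first.
  rewrite (bigD1 k0)//= muleC; congr (_ * _); first by rewrite /H/= ltnSn.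
  by apply: eq_bigr => k kk0; rewrite -Hm1.
apply: ge0_integral_weighted => //.
- rewrite (_ : G = fun w => \prod_k if k != k0 then H m A k (xi k w) else 1)%R.
    apply: measurable_prod => k _; case: (k != k0) => //.
    by apply: measurableT_comp => //; exact: mH.
  by apply/funext => w; rewrite /G big_mkcond.
- by move=> w; apply: prodr_ge0.
- apply: prode_fin_num => k _.
  rewrite ge0_fin_numE; last by apply: integral_ge0 => z _; rewrite lee_fin.
  rewrite /H; case: ifP => // _; rewrite integral_indic// setIT.
  exact: le_lt_trans (probability_le1 _ _) (ltry _).
move=> B mB; pose A' k := if k == k0 then B else A k.
have mA' k : measurable (A' k) by rewrite /A'; case: ifP.
have HA' k : k != k0 -> H m A' k = H m A k by rewrite /H /A' => /negbTE ->.
have Hk0 : H m A' k0 = \1_B by rewrite /H /A' /= ltnn eqxx.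
have := IH (ltnW mN) _ mA'; rewrite (bigD1 k0)//= Hk0 integral_indic// setIT.
have <- : \prod_(k | k != k0) \int[PX]_z (H m A' k z)%:E = C.
  by apply: eq_bigr => k kk0; rewrite HA'.
rewrite muleC => <-.
apply: eq_integral => w _; rewrite (bigD1 k0)//= Hk0 mulrC.
by congr (_ * _)%:E; apply: eq_bigr => k kk0; rewrite HA'.
Qed.

Lemma iid_chernoff (G : Xi -> R) (b s : R) :
  measurable_fun setT G ->
  \int[PX]_z (expR (G z))%:E <= (expR b)%:E ->
  PO [set w | (s < \sum_k G (xi k w))%R] <= (expR (N%:R * b - s))%:E.
Proof.
move=> mG Gb; set S := [set w | _].
have mX k : measurable_fun setT (xi k) by exact: measurable_funP.
have mSG : measurable_fun setT (fun w => \sum_k G (xi k w))%R.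
  by apply: measurable_sum => k; exact: measurableT_comp.
have mS : measurable S by exact: measurable_lt.
have E0 z : (0 <= expR (G z))%R by exact: expR_ge0.
have : (expR s)%:E * PO S <= (expR (N%:R * b))%:E.
  apply: (@le_trans _ _ (\int[PO]_w (\prod_k expR (G (xi k w)))%:E)).
    rewrite -(setIT S) -integral_indic// -ge0_integralZl//; last first.
      by apply/measurable_EFinP; exact: measurable_indic.
    apply: ge0_le_integral => //.
    - by apply/measurable_EFinP; apply: measurable_funM.
    - apply/measurable_EFinP; apply: measurable_prod => k _.
      by apply: measurableT_comp => //; exact: measurableT_comp.
    - move=> w _; rewrite -expR_sum lee_fin indicE.
      have [Sw|_] := boolP (w \in S); last by rewrite mulr0 expR_ge0.
      by rewrite mulr1 ler_expR ltW//; move: Sw; rewrite inE.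
  have Goo : \int[PX]_z (expR (G z))%:E \is a fin_num.
    rewrite ge0_fin_numE; first exact: le_lt_trans Gb (ltry _).
    by apply: integral_ge0 => z _; rewrite lee_fin.
  rewrite (@expectation_prod (fun=> expR \o G))//; last 2 first.
  - by move=> k; exact: measurableT_comp.
  - by move=> k; exact: le_lt_trans Gb (ltry _).
  rewrite /= -(fineK Goo) prodEFin lee_fin prodr_const card_ord expRM_natl.
  rewrite lerXn2r ?nnegrE ?expR_ge0// -?lee_fin ?fineK//.
  by apply: integral_ge0 => z _; rewrite lee_fin.
rewrite expRB EFinM -(fineK (fin_num_measure PO _ mS)) -!EFinM !lee_fin.
by rewrite ler_pdivlMr ?expR_gt0// mulrC.
Qed.

(** Chernoff bound for [l * X - (l * X) ^+ 2 / 6]. The event caps the sum of the subtracted squares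
    by [W], so a second moment of [X] suffices; the variance proxy combines the empirical part [W]
    with the part [2 * N * v] of the law. *)
Lemma self_normalized_tail (X : Xi -> R) (u v W : R) :
  (0 <= u)%R -> (0 < W + 2 * N%:R * v)%R ->
  PX.-integrable setT (EFin \o X) -> \int[PX]_z (X z)%:E = 0 ->
  \int[PX]_z (X z ^+ 2)%:E <= v%:E ->
  PO [set w | (u < \sum_k X (xi k w))%R /\ (\sum_k X (xi k w) ^+ 2 <= W)%R] <=
  (expR (- (3 * u ^+ 2 / (2 * (W + 2 * N%:R * v)))))%:E.
Proof.
move=> u0 V0 iX X0 Xv; set V := (_ + _)%R in V0 *.
have mX : measurable_fun setT X by apply/measurable_EFinP; case/integrableP : iX.
have v0 : (0 <= v)%R.
  by rewrite -lee_fin (le_trans _ Xv)// integral_ge0// => z _; rewrite lee_fin sqr_ge0.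
(* The minimizer of the exponent [l ^+ 2 * V / 6 - l * u]. *)
pose l : R := (3 * u / V)%R.
have l0 : (0 <= l)%R by rewrite divr_ge0 ?mulr_ge0// ltW.
pose G z : R := (l * X z - (l * X z) ^+ 2 / 6)%R.
have mG : measurable_fun setT G.
  apply: measurable_funB; first exact: measurable_funM.
  by apply: measurable_funM => //; apply: measurable_funX; exact: measurable_funM.
have iX2 : PX.-integrable setT (fun z => (X z ^+ 2)%:E).
  apply/integrableP; split; first by apply/measurable_EFinP; exact: measurable_funX.
  under eq_integral do rewrite gee0_abs ?lee_fin ?sqr_ge0//.
  exact: le_lt_trans Xv (ltry _).
have GE : \int[PX]_z (expR (G z))%:E <= (expR (l ^+ 2 / 3 * v))%:E.
  apply: (@le_trans _ _ (\int[PX]_z (1%:E + (l%:E * (X z)%:E + (l ^+ 2 / 3)%:E * (X z ^+ 2)%:E)))).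
    apply: ge0_le_integral => //.
    - by apply/measurable_EFinP; exact: measurableT_comp.
    - apply/measurable_EFinP; apply: measurable_funD => //.
      apply: measurable_funD; first exact: measurable_funM.
      by apply: measurable_funM => //; exact: measurable_funX.
    - move=> z _; rewrite -!EFinM -!EFinD lee_fin.
      by have := expR_sub_sqr_le (l * X z); rewrite /G; lra.
  rewrite integralD//=; last 2 first.
  - exact: finite_measure_integrable_cst.
  - by apply: integrableD => //; exact: integrableZl.
  rewrite integralD//=; [|exact: integrableZl..].
  have -> : \int[PX]_z (1 : \bar R) = 1 by rewrite integral_cst//= mul1e probability_setT.
  rewrite !integralZl// X0 mule0 add0e.
  have := expR_ge1Dx (l ^+ 2 / 3 * v)%R; rewrite -lee_fin; apply: le_trans.
  rewrite EFinD (EFinM _ v); apply: leeD => //; apply: lee_wpmul2l => //.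
  by rewrite lee_fin divr_ge0 ?sqr_ge0.
have mXk k : measurable_fun setT (fun w => X (xi k w)).
  by apply: (measurableT_comp mX); exact: measurable_funP.
have mE : measurable [set w | (u < \sum_k X (xi k w))%R /\ (\sum_k X (xi k w) ^+ 2 <= W)%R].
  apply: measurableI.
    by apply: measurable_lt => //; exact: measurable_sum.
  apply: measurable_le => //.
  by apply: measurable_sum => k; exact: measurable_funX.
(* For [u = 0] the optimal [l] vanishes and the strict inequality is lost, but the claimed bound is
   then 1. *)
have [u_eq0|u_neq0] := eqVneq u 0%R.
  rewrite {2}u_eq0 expr0n/= mulr0 mul0r oppr0 expR0; exact: probability_le1.
have l_gt0 : (0 < l)%R by rewrite divr_gt0// mulr_gt0// lt_neqAle eq_sym u_neq0.
have -> : (- (3 * u ^+ 2 / (2 * V)) =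
    N%:R * (l ^+ 2 / 3 * v) - (l * u - l ^+ 2 * W / 6))%R.
  have -> : (N%:R * (l ^+ 2 / 3 * v) - (l * u - l ^+ 2 * W / 6) =
      l ^+ 2 * V / 6 - l * u)%R by rewrite /V; field.
  by rewrite /l; field; rewrite gt_eqF.
apply: le_trans (iid_chernoff (l * u - l ^+ 2 * W / 6) mG GE).
apply: le_measure; rewrite ?inE//.
  apply: measurable_lt => //; apply: measurable_sum => k; apply: (measurableT_comp mG).
  exact: measurable_funP.
move=> w /= [uX XW]; rewrite /G big_split/= -mulr_sumr sumrN -mulr_suml.
have -> : (\sum_k (l * X (xi k w)) ^+ 2 = l ^+ 2 * \sum_k X (xi k w) ^+ 2)%R.
  by rewrite mulr_sumr; apply: eq_bigr => k _; rewrite exprMn.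
apply: ltr_leD; first by rewrite ltr_pM2l.
by rewrite lerN2 ler_pM2r ?invr_gt0// ler_pM2l// exprn_gt0.
Qed.
End iid.

(** * From greatness to goodness *)

Lemma powR_inv (R : realType) (x p : R) : 0 < x -> x^-1 `^ p = (x `^ p)^-1.
Proof. by move=> x0; rewrite -powR_inv1 ?(ltW x0)// -powRrM mulN1r powRN. Qed.

(* [b] is the truncation level and [l] the exponent of the Chernoff bound; it
   makes [expR (l * b) = y^-1]. *)
Lemma truncation_level_bound (R : realType) (n p k s y b l : R) :
  0 < n -> 0 < s -> 2 <= p -> 1 <= k ->
  y = k * Num.sqrt (p / n) -> y < 1 -> b = n * s / p -> l = - ln y / b ->
  n * ((k * s / b) `^ p) +
    expR (n * (l ^+ 2 * expR (l * b) * (2 * (k * s) ^+ 2)) - l * (n * s)) <=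
  (2 * expR 8 * y) `^ p.
Proof.
move=> n0 s0 p2 k1 yE y_lt1 bE lE.
have p0 : 0 < p by exact: lt_le_trans p2.
have k0 : 0 < k by exact: lt_le_trans k1.
have n_neq0 : n != 0 by rewrite gt_eqF.
have p_neq0 : p != 0 by rewrite gt_eqF.
have s_neq0 : s != 0 by rewrite gt_eqF.
set r := Num.sqrt (p / n) in yE.
have r0 : 0 < r by rewrite sqrtr_gt0 divr_gt0.
have r2 : r ^+ 2 = p / n by rewrite sqr_sqrtr// ltW// divr_gt0.
have r1 : r <= 1 by rewrite (le_trans _ (ltW y_lt1))// yE ler_peMl// ltW.
have y0 : 0 < y by rewrite yE mulr_gt0.
have y_neq0 : y != 0 by rewrite gt_eqF.
have b_neq0 : b != 0 by rewrite bE gt_eqF// divr_gt0// mulr_gt0.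
have yp : y `^ p = expR (p * ln y) by rewrite /powR (negbTE y_neq0).
have E8 : expR 8 `^ p = expR (8 * p) by rewrite expRM.
have -> : (2 * expR 8 * y) `^ p = 2 `^ p * (expR (8 * p) * expR (p * ln y)).
  by rewrite -mulrA powRM ?mulr_ge0 ?expR_ge0 ?(ltW y0)// powRM ?expR_ge0 ?(ltW y0)// E8 yp.
set Z := expR (8 * p) * expR (p * ln y).
have Z0 : 0 < Z by rewrite mulr_gt0 ?expR_gt0.
have two : 2 <= 2 `^ p :> R.
  by rewrite -[leLHS]powRr1// ler_powR//; lra.
(* The power of 2 is at least 2 and pays for the two summands, each of which is at most [Z]. *)
suff [A B] : n * (k * s / b) `^ p <= Z /\
    expR (n * (l ^+ 2 * expR (l * b) * (2 * (k * s) ^+ 2)) - l * (n * s)) <= Z.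
  by have := ler_wpM2r (ltW Z0) two; lra.
split.
  have -> : k * s / b = y * r.
    by rewrite yE -(mulrA k r r) -expr2 r2 bE; field; rewrite n_neq0 s_neq0 p_neq0.
  rewrite powRM ?(ltW y0) ?(ltW r0)// yp /Z mulrCA mulrC ler_wpM2r ?expR_ge0//.
  (* Since [r <= 1] and [2 <= p], the power drops to the square [p / n]. The first summand then
     costs a factor [p], absorbed by [expR (8 * p)]. *)
  have rp : r `^ p <= p / n.
    rewrite -r2 -powR_mulrn ?(ltW r0)//.
    have : r^-1 `^ 2 <= r^-1 `^ p by rewrite ler_powR// invf_ge1.
    rewrite !powR_inv// lef_pV2 ?posrE ?powR_gt0//.
  have : n * r `^ p <= p by rewrite -[leRHS](divfK n_neq0) mulrC ler_wpM2r// ltW.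
  move=> /le_trans; apply; have := expR_ge1Dx (8 * p); lra.
rewrite /Z -expRD ler_expR; set L := - ln y.
have lb : l * b = L by rewrite lE divfK.
have L0 : 0 <= L by rewrite oppr_ge0 ltW// ln_lt0// y0.
have -> : n * (l ^+ 2 * expR (l * b) * (2 * (k * s) ^+ 2)) - l * (n * s) =
    p * (2 * (L ^+ 2 * y)) - p * L.
  have -> : expR (l * b) = y^-1 by rewrite lb /L expRN lnK.
  have y2 : y ^+ 2 = k ^+ 2 * (p / n) by rewrite yE exprMn r2.
  have -> : p * (2 * (L ^+ 2 * y)) = p * (2 * (L ^+ 2 * (y ^+ 2 / y))).
    by rewrite expr2 mulfK.
  rewrite y2 lE -/L bE; field.
  by rewrite n_neq0 s_neq0 p_neq0 y_neq0.
(* As [y = expR (- L)], this is the square of [L / 2 <= expR (L / 2)]. The exponent becomes at most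
   [8 * p - p * L], whence the constant [expR 8]. *)
have Ly : L ^+ 2 * y <= 4.
  have yL : y = (expR (L / 2) ^+ 2)^-1.
    by rewrite -expRM_natl mulrC divfK// /L expRN invrK lnK.
  have := expR_ge1Dx (L / 2) => eL.
  rewrite yL ler_pdivrMr ?exprn_gt0 ?expR_gt0//.
  have : L / 2 <= expR (L / 2) by lra.
  by move=> /(lerXn2r 2); rewrite !nnegrE divr_ge0 ?expR_ge0// => /(_ isT isT); lra.
have : p * (2 * (L ^+ 2 * y)) <= p * 8 by rewrite ler_wpM2l ?(ltW p0)//; lra.
rewrite /L; lra.
Qed.

Section truncated_tail.
Context (R : realType) (dX dO : measure_display).
Context (Xi : measurableType dX) (Omega : measurableType dO).
Variables (PX : probability Xi R) (PO : probability Omega R).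
Variables (N : nat) (xi : 'I_N -> {RV PO >-> Xi}).
Hypothesis iid : iid_sample PX xi.
Local Open Scope ereal_scope.

(** Either some term exceeds [b], or the sum equals that of the truncated terms. Truncating only
    from above lowers the mean and, as [0 <= b], does not increase the square, so the exponential
    moment of [X'] is bounded through the moments of [X] and no recentring is required. *)
Lemma truncated_tail (X : Xi -> R) (u v b l : R) :
  (0 <= l)%R -> (0 <= b)%R ->
  PX.-integrable setT (EFin \o X) -> \int[PX]_z (X z)%:E = 0 ->
  \int[PX]_z (X z ^+ 2)%:E <= v%:E ->
  PO [set w | (u < \sum_k X (xi k w))%R] <=
  N%:R%:E * PX [set z | (b < X z)%R] +
  (expR (N%:R * (l ^+ 2 * expR (l * b) * v) - l * u))%:E.
Proof.
move=> l0 b0 iX X0 Xv.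
have mX : measurable_fun setT X by apply/measurable_EFinP; case/integrableP : iX.
pose X' z : R := Num.min (X z) b.
have mX' : measurable_fun setT X' by exact: measurable_minr.
have X'X z : (X' z <= X z)%R by rewrite /X' ge_min lexx.
have X'b z : (X' z <= b)%R by rewrite /X' ge_min lexx orbT.
have X'2 z : (X' z ^+ 2 <= X z ^+ 2)%R.
  rewrite /X' minEle; case: ifPn => //; rewrite -ltNge => bX.
  by rewrite lerXn2r ?nnegrE ?(le_trans b0)// ltW.
pose e := expR (l * b).
have v0 : (0 <= v)%R.
  by rewrite -lee_fin (le_trans _ Xv)// integral_ge0// => z _; rewrite lee_fin sqr_ge0.
have e0 : (0 <= l ^+ 2 * e)%R by rewrite mulr_ge0 ?sqr_ge0 ?expR_ge0.
have iX2 : PX.-integrable setT (fun z => (X z ^+ 2)%:E).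
  apply/integrableP; split; first by apply/measurable_EFinP; exact: measurable_funX.
  under eq_integral do rewrite gee0_abs ?lee_fin ?sqr_ge0//.
  exact: le_lt_trans Xv (ltry _).
have GE : \int[PX]_z (expR (l * X' z))%:E <= (expR (l ^+ 2 * e * v))%:E.
  apply: (@le_trans _ _ (\int[PX]_z (1%:E + (l%:E * (X z)%:E + (l ^+ 2 * e)%:E * (X z ^+ 2)%:E)))).
    apply: ge0_le_integral => //.
    - apply/measurable_EFinP; apply: measurableT_comp => //.
      exact: measurable_funM.
    - apply/measurable_EFinP; apply: measurable_funD => //.
      apply: measurable_funD; first exact: measurable_funM.
      by apply: measurable_funM => //; exact: measurable_funX.
    - move=> z _; rewrite -!EFinM -!EFinD lee_fin.
      have := @expR_le_quad _ (l * X' z) (l * b) (ler_wpM2l l0 (X'b z)) (mulr_ge0 l0 b0).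
      move=> /le_trans; apply; rewrite -addrA lerD2l lerD//; first exact: ler_wpM2l.
      rewrite exprMn -/e -mulrA [(X' z ^+ 2 * _)%R]mulrC mulrA ler_wpM2l//.
  rewrite integralD//=; last 2 first.
  - exact: finite_measure_integrable_cst.
  - by apply: integrableD => //; exact: integrableZl.
  rewrite integralD//=; [|exact: integrableZl..].
  have -> : \int[PX]_z (1 : \bar R) = 1 by rewrite integral_cst//= mul1e probability_setT.
  rewrite !integralZl// X0 mule0 add0e.
  have := expR_ge1Dx (l ^+ 2 * e * v)%R; rewrite -lee_fin; apply: le_trans.
  by rewrite EFinD (EFinM _ v); apply: leeD => //; apply: lee_wpmul2l.
have mXk k : measurable_fun setT (fun w => X (xi k w)).
  by apply: (measurableT_comp mX); exact: measurable_funP.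
have mX'k k : measurable_fun setT (fun w => X' (xi k w)).
  by apply: (measurableT_comp mX'); exact: measurable_funP.
have mb k : measurable [set w | (b < X (xi k w))%R] by exact: measurable_lt.
have mU : measurable (\big[setU/set0]_k [set w | (b < X (xi k w))%R]).
  by apply: bigsetU_measurable => k _.
have mG : measurable_fun setT (fun z => l * X' z)%R by exact: measurable_funM.
have mS : measurable [set w | (l * u < \sum_k l * X' (xi k w))%R].
  by apply: measurable_lt => //; apply: measurable_sum => k; exact: measurable_funM.
have mS' : measurable [set w | (u < \sum_k X' (xi k w))%R].
  by apply: measurable_lt => //; apply: measurable_sum => k.
apply: (@le_trans _ _ (PO (\big[setU/set0]_k [set w | (b < X (xi k w))%R] `|`
    [set w | (u < \sum_k X' (xi k w))%R]))).
  apply: le_measure; rewrite ?inE//.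
  - by apply: measurable_lt => //; exact: measurable_sum.
  - exact: measurableU.
  move=> w /= uX; have [/existsP[k bX]|/existsPn nX] := boolP [exists k, b < X (xi k w)]%R.
    by left; rewrite -bigcup_pred; exists k.
  right; suff -> : (\sum_k X' (xi k w) = \sum_k X (xi k w))%R by [].
  by apply: eq_bigr => k _; rewrite /X' min_l// leNgt.
apply: (le_trans (measureU2 _ _ _)) => //; apply: leeD.
  apply: (le_trans (finite_union_bound _ _)) => //.
  rewrite (eq_bigr (fun=> PX [set z | (b < X z)%R])) => [|k _].
    rewrite -(fineK (fin_num_measure PX _ (measurable_lt (f := cst b) _ mX)))//.
    by rewrite sumEFin sumr_const card_ord -EFinM lee_fin mulr_natl.
  exact/iid.1/measurable_lt.
have [l_eq0|l_neq0] := eqVneq l 0%R.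
  rewrite l_eq0 expr0n/= !mul0r mulr0 subr0 expR0; exact: probability_le1.
have l_gt0 : (0 < l)%R by rewrite lt_neqAle eq_sym l_neq0.
apply: le_trans (iid_chernoff iid (l * u)%R mG GE).
apply: le_measure; rewrite ?inE// => w /=.
by rewrite -mulr_sumr ltr_pM2l.
Qed.

(** As the mean is at most [s2], an empirical mean above [2 * s2] forces the centred sum above
    [N * s2]. The moment of order [p] controls a single large term; the second moment, itself
    derived from it, controls the truncated sum. *)
Lemma great_fun_good (p kp s2 : R) (h : Xi -> R) :
  (0 < N)%N -> (0 < s2)%R -> (2 <= p)%R -> (1 <= kp)%R ->
  great_fun PX p kp s2 h ->
  good_fun PX xi ((2 * expR 8 * kp * Num.sqrt (p / N%:R)) `^ p)%R s2 h.
Proof.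
move=> N0 s20 p2 kp1 [mh h0 Eh hp]; split=> //.
set c := (2 * expR 8)%R.
have p0 : (0 < p)%R by rewrite (lt_le_trans _ p2).
have p_neq0 : p != 0%R by rewrite gt_eqF.
have kp0 : (0 < kp)%R by rewrite (lt_le_trans _ kp1).
have NR0 : (0 < N%:R :> R)%R by rewrite ltr0n.
set y := (kp * Num.sqrt (p / N%:R))%R; rewrite -!mulrA -/y mulrA -/c.
have y0 : (0 < y)%R by rewrite mulr_gt0// sqrtr_gt0 divr_gt0.
have c0 : (0 < c)%R by rewrite mulr_gt0// expR_gt0.
(* If [c * y] is at least 1, so is the claimed bound. Otherwise [y < 1], which makes the exponent
   [- ln y / b] nonnegative. *)
have [cy1|cy1] := leP 1%R (c * y)%R.
  apply: (le_trans (probability_le1 _ _)).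
    apply: measurable_lt => //; apply: measurable_funM => //.
    apply: measurable_sum => k; apply: (measurableT_comp mh).
    exact: measurable_funP.
  by rewrite lee_fin -(powRr0 (c * y)) ler_powR// ltW.
have c1 : (1 <= c)%R by have := expR_ge1Dx (8 : R); rewrite /c; lra.
have y1 : (y < 1)%R.
  by apply: le_lt_trans cy1; rewrite ler_peMl// ltW.
have Efin : 'E_PX[h] \is a fin_num.
  by rewrite ge0_fin_numE ?expectation_ge0// (le_lt_trans Eh)// ltry.
pose m := fine 'E_PX[h].
have ms2 : (m <= s2)%R by rewrite -lee_fin fineK.
pose X z := (h z - m)%R.
have mX : measurable_fun setT X by exact: measurable_funB.
have ih : PX.-integrable setT (EFin \o h).
  apply/integrableP; split; first exact/measurable_EFinP.
  under eq_integral do rewrite gee0_abs ?lee_fin//.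
  by move: Efin; rewrite ge0_fin_numE ?expectation_ge0// unlock.
have iX : PX.-integrable setT (EFin \o X).
  rewrite (_ : EFin \o X = (EFin \o h) \- (cst m%:E))%E; last exact/funext.
  by apply: integrableB => //; exact: finite_measure_integrable_cst.
have X0 : \int[PX]_z (X z)%:E = 0.
  under eq_integral do rewrite EFinB.
  rewrite integralB//; last exact: finite_measure_integrable_cst.
  rewrite integral_cst//= probability_setT mule1.
  by rewrite [X in X - _](_ : _ = m%:E) ?subee// /m fineK// unlock.
pose K := (kp * s2)%R.
have K0 : (0 < K)%R by rewrite mulr_gt0.
have mXp : measurable_fun setT (fun z => `|X z| `^ p)%R.
  apply: (measurableT_comp (measurable_powR p)); exact: measurableT_comp.
have Xp : \int[PX]_z (`|X z| `^ p)%:E <= (K `^ p)%:E.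
  have XE : 'N[PX]_(p%:E)[ (fun z => (h z)%:E - 'E_PX[h]) ] `^ p = \int[PX]_z (`|X z| `^ p)%:E.
    rewrite poweR_Lnorm//; apply: eq_integral => z _.
    by rewrite -[X in (`|_ - X|) `^ _](fineK Efin) -EFinB abse_EFin poweR_EFin.
  rewrite -XE -poweR_EFin gt0_ler_poweR ?(ltW p0)// in_itv/= leey andbT ?Lnorm_ge0//.
  by rewrite lee_fin ltW.
(* Split at [|X| = K]: below, the square is at most [K ^+ 2]; above, [2 <= p] bounds the square of
   [|X| / K] by its power of order [p]. Adding the two cases gives the factor 2. *)
have Xv : \int[PX]_z (X z ^+ 2)%:E <= (2 * K ^+ 2)%:E.
  apply: (@le_trans _ _ (\int[PX]_z ((K ^+ 2)%:E + (K ^+ 2 / K `^ p)%:E * (`|X z| `^ p)%:E))).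
    apply: ge0_le_integral => //.
    - by move=> z _; rewrite lee_fin sqr_ge0.
    - by apply/measurable_EFinP; exact: measurable_funX.
    - by apply/measurable_EFinP; apply: measurable_funD => //; exact: measurable_funM.
    move=> z _; rewrite -EFinM -EFinD lee_fin.
    have Kp0 : (0 < K `^ p)%R by exact: powR_gt0.
    have [xK|Kx] := leP `|X z|%R K.
      apply: (@le_trans _ _ (K ^+ 2)%R).
        by rewrite -real_normK ?num_real// lerXn2r ?nnegrE ?(ltW K0).
      by rewrite lerDl mulr_ge0 ?powR_ge0// divr_ge0 ?sqr_ge0// ltW.
    have : ((`|X z| / K) `^ 2 <= (`|X z| / K) `^ p)%R.
      by rewrite ler_powR// ler_pdivlMr// mul1r ltW.
    have Kinv : (0 <= K^-1)%R by rewrite invr_ge0 ltW.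
    rewrite powR_mulrn ?divr_ge0 ?(ltW K0)// powRM// exprMn real_normK ?num_real//.
    rewrite powR_inv//.
    move=> /(ler_wpM2l (sqr_ge0 K)).
    have -> : (K ^+ 2 * (X z ^+ 2 * K^-1 ^+ 2) = X z ^+ 2)%R.
      by rewrite exprVn mulrCA divff ?mulr1// expf_neq0// gt_eqF.
    by move=> /le_trans; apply; rewrite mulrCA mulrC lerDr sqr_ge0.
  rewrite ge0_integralD//=; last 3 first.
  - by move=> z _; rewrite lee_fin sqr_ge0.
  - by move=> z _; rewrite -EFinM lee_fin mulr_ge0 ?powR_ge0// divr_ge0 ?sqr_ge0 ?powR_ge0.
  - by apply/measurable_EFinP; exact: measurable_funM.
  rewrite integral_cst//= probability_setT mule1 ge0_integralZl//; last 2 first.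
  - exact/measurable_EFinP.
  - by rewrite lee_fin divr_ge0 ?sqr_ge0 ?powR_ge0.
  have -> : ((2 * K ^+ 2)%:E = (K ^+ 2)%:E + (K ^+ 2 / K `^ p)%:E * (K `^ p)%:E).
    rewrite -EFinM -EFinD divfK; first by congr EFin; ring.
    by rewrite gt_eqF// powR_gt0.
  apply: leeD => //; apply: lee_wpmul2l => //.
  by rewrite lee_fin divr_ge0 ?sqr_ge0 ?powR_ge0.
pose b := (N%:R * s2 / p)%R.
have b0 : (0 < b)%R by rewrite divr_gt0 ?mulr_gt0.
have mb : measurable [set z | (b < X z)%R] by exact: measurable_lt.
have bp0 : (0 < b `^ p)%R by exact: powR_gt0.
(* The Markov inequality at order [p]. *)
have Xb : PX [set z | (b < X z)%R] <= ((K / b) `^ p)%:E.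
  have : (b `^ p)%:E * PX [set z | (b < X z)%R] <= (K `^ p)%:E.
    apply: le_trans Xp; rewrite -(setIT [set z | _]) -integral_indic//.
    rewrite -ge0_integralZl//; last 2 first.
    - by apply/measurable_EFinP.
    - by rewrite lee_fin powR_ge0.
    apply: ge0_le_integral => //.
    - by move=> z _; rewrite -EFinM lee_fin mulr_ge0 ?powR_ge0.
    - by apply/measurable_EFinP; exact: measurable_funM.
    - exact/measurable_EFinP.
    move=> z _; rewrite -EFinM lee_fin indicE.
    have [|_] := boolP (z \in _); last by rewrite mulr0 powR_ge0.
    rewrite inE/= mulr1 => bX; rewrite ge0_ler_powR ?nnegrE ?(ltW p0) ?(ltW b0)//.
    by rewrite (le_trans (ltW bX))// ler_norm.
  rewrite -(fineK (fin_num_measure PX _ mb)) -EFinM !lee_fin => bK.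
  rewrite powRM ?(ltW K0) ?invr_ge0 ?(ltW b0)//.
  by rewrite powR_inv// ler_pdivlMr// mulrC.
have l0 : (0 <= - ln y / b)%R by rewrite divr_ge0// ?ltW// oppr_gt0 ln_lt0 ?y0.
have tail := truncated_tail (N%:R * s2)%R l0 (ltW b0) iX X0 Xv.
have := truncation_level_bound NR0 s20 p2 kp1 (erefl y) y1 (erefl b) (erefl _); rewrite -lee_fin; apply: le_trans.
apply: (@le_trans _ _ (PO [set w | N%:R * s2 < \sum_k X (xi k w)]%R)).
  apply: le_measure; rewrite ?inE//.
  - apply: measurable_lt => //; apply: measurable_funM => //.
    apply: measurable_sum => k; apply: (measurableT_comp mh).
    exact: measurable_funP.
  - apply: measurable_lt => //.
    apply: measurable_sum => k; apply: (measurableT_comp mX).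
    exact: measurable_funP.
  move=> w /=; rewrite /emp_mean ltr_pdivlMr// /X sumrB sumr_const card_ord.
  have : (m *+ N <= N%:R * s2)%R by rewrite -[leLHS]mulr_natl ler_wpM2l.
  lra.
apply: (le_trans tail); rewrite EFinD; apply: leeD => //.
by rewrite EFinM; apply: lee_wpmul2l => //; rewrite lee_fin ltW.
Qed.
End truncated_tail.

(** * Generic chaining *)

(** A number in [0, 1] is at most its [a]-th power when [a <= 1]; this is applied to the shares of
    [x] and [y] in [x + y], which add up to 1. *)
Lemma powR_subadditive (R : realType) (a x y : R) : 0 < a -> a <= 1 -> 0 <= x -> 0 <= y ->
  (x + y) `^ a <= x `^ a + y `^ a.
Proof.
move=> a0 a1 x0 y0; have [xy0|xy0] := eqVneq (x + y) 0.
  by rewrite xy0 powR0 ?gt_eqF// addr_ge0// powR_ge0.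
have xy_gt0 : 0 < x + y by rewrite lt_neqAle eq_sym xy0 addr_ge0.
have part u : 0 <= u -> u <= x + y -> u / (x + y) * (x + y) `^ a <= u `^ a.
  move=> u0 uxy; have [->|u_neq0] := eqVneq u 0; first by rewrite !mul0r powR_ge0.
  rewrite -[in leRHS](divfK xy0 u) powRM ?divr_ge0 ?(ltW xy_gt0)//.
  rewrite ler_wpM2r ?powR_ge0// -[leLHS]powRr1 ?divr_ge0 ?(ltW xy_gt0)//.
  rewrite ger_powR// ler_pdivrMr// mul1r uxy andbT divr_gt0//.
  by rewrite lt_neqAle eq_sym u_neq0.
have := part x x0; have := part y y0; rewrite lerDl lerDr => /(_ x0) + /(_ y0).
move=> py px; apply: le_trans (lerD px py).
by rewrite -mulrDl -mulrDl divff// mul1r.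
Qed.

Section norm_distance.
Variables (R : realType) (d : nat) (nrm : 'rV[R]_d -> R).
Hypothesis nrmP : is_norm nrm.

Lemma is_norm0 : nrm 0 = 0.
Proof. by have [_ nZ _] := nrmP; rewrite -(scale0r 0) nZ normr0 mul0r. Qed.

Lemma is_normN x : nrm (- x) = nrm x.
Proof. by have [_ nZ _] := nrmP; rewrite -scaleN1r nZ normrN1 mul1r. Qed.

Lemma is_norm_distC x y : nrm (x - y) = nrm (y - x).
Proof. by rewrite -opprB is_normN. Qed.

Lemma is_norm_ge0 x : 0 <= nrm x.
Proof.
have [_ _ nD] := nrmP; have := nD x (- x).
by rewrite subrr is_norm0 is_normN -mulr2n pmulrn_lge0.
Qed.

Lemma is_norm_dist_triangle y x z : nrm (x - z) <= nrm (x - y) + nrm (y - z).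
Proof. by have [_ _ nD] := nrmP; rewrite (le_trans _ (nD _ _))// addrA subrK. Qed.

End norm_distance.

Section chaining_bound.
Variables (R : realType) (d : nat) (nrm : 'rV[R]_d -> R).
Hypothesis nrmP : is_norm nrm.
Variables (alpha : R) (M : set 'rV[R]_d) (x0 : 'rV[R]_d).
Hypotheses (alpha0 : 0 < alpha) (alpha1 : alpha <= 1).
Variables (u : nat -> nat -> 'rV[R]_d) (delta : nat -> R) (S : R).
Hypothesis uM : forall j i, M (u j i).
Hypothesis net : forall j x, M x ->
  exists i, (i < 2 ^ (2 ^ j))%N /\ nrm (x - u j i) <= delta j.
Hypothesis sumS : forall n,
  \sum_(j < n) 2 `^ (j%:R / 2) * delta j `^ alpha <= S.

(** The deterministic half of chaining. As the partitions are not nested, successive net points of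
    [x] are compared through [x], and each link costs the radii of two levels: hence the factor 2.
    The Hoelder constant [L] is absent from the bound, since it only makes the end of the chain
    converge to [x]. *)
Lemma chaining_bound (j0 : nat) (g : 'rV[R]_d -> R) (a b L : R) :
  0 <= b -> 0 <= L ->
  (forall i, (i < 2 ^ (2 ^ j0))%N -> `|g (u j0 i) - g x0| <= a) ->
  (forall j i i', (j0 <= j)%N -> (i < 2 ^ (2 ^ j))%N ->
    (i' < 2 ^ (2 ^ j.+1))%N ->
    `|g (u j.+1 i') - g (u j i)| <=
      b * 2 `^ (j%:R / 2) * nrm (u j.+1 i' - u j i) `^ alpha) ->
  (forall x y, M x -> M y -> `|g x - g y| <= L * nrm (x - y) `^ alpha) ->
  forall x, M x -> `|g x - g x0| <= a + 2 * b * S.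
Proof.
move=> b0 L0 first links hold x Mx.
have w_ge0 j : 0 <= 2 `^ (j%:R / 2) :> R by exact: powR_ge0.
pose i j := projT1 (cid (net j Mx)).
have iP j : (i j < 2 ^ (2 ^ j))%N /\ nrm (x - u j (i j)) <= delta j.
  exact: (projT2 (cid (net j Mx))).
pose v j := u j (i j).
have delta0 j : 0 <= delta j by apply: le_trans (is_norm_ge0 nrmP _) (iP j).2.
have da0 j : 0 <= delta j `^ alpha by exact: powR_ge0.
have xv j : nrm (x - v j) `^ alpha <= delta j `^ alpha.
  rewrite ge0_ler_powR ?nnegrE ?(ltW alpha0)//; first exact: is_norm_ge0.
  exact: (iP j).2.
have vv j : nrm (v j.+1 - v j) `^ alpha <= delta j.+1 `^ alpha + delta j `^ alpha.
  apply: le_trans (lerD (xv j.+1) (xv j)).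
  apply: le_trans (powR_subadditive alpha0 alpha1 (is_norm_ge0 nrmP _) (is_norm_ge0 nrmP _)).
  rewrite ge0_ler_powR ?nnegrE ?(ltW alpha0)// ?addr_ge0 ?is_norm_ge0//.
  by rewrite [in leRHS]is_norm_distC// is_norm_dist_triangle.
have step m : `|g (v (j0 + m)%N) - g x0| <= a +
    b * (\sum_(j < j0 + m) 2 `^ (j%:R / 2) * delta j `^ alpha +
         \sum_(j < (j0 + m).+1) 2 `^ (j%:R / 2) * delta j `^ alpha).
  elim: m => [|m IH].
    rewrite addn0 (le_trans (first _ (iP j0).1))// lerDl mulr_ge0// addr_ge0//.
      by apply: sumr_ge0 => j _; rewrite mulr_ge0.
    by apply: sumr_ge0 => j _; rewrite mulr_ge0.
  rewrite addnS; set n := (j0 + m)%N in IH *.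
  have lk := links n (i n) (i n.+1) (leq_addr _ _) (iP _).1 (iP _).1.
  rewrite -/(v _) -/(v _) in lk.
  apply: (le_trans (ler_distD (g (v n)) _ _)); apply: (le_trans (lerD lk IH)).
  rewrite !(big_ord_recr n.+1)/= big_ord_recr/=.
  set s := \sum_(_ < n) _.
  have wS : 2 `^ (n%:R / 2) <= 2 `^ (n.+1%:R / 2) :> R.
    by rewrite ler_powR ?ler1n// ler_pM2r// ler_nat.
  have h1 : 2 `^ (n%:R / 2) * nrm (v n.+1 - v n) `^ alpha <=
      2 `^ (n.+1%:R / 2) * delta n.+1 `^ alpha + 2 `^ (n%:R / 2) * delta n `^ alpha.
    apply: (le_trans (ler_wpM2l (w_ge0 n) (vv n))); rewrite mulrDr lerD2r.
    by rewrite ler_wpM2r.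
  have := ler_wpM2l b0 h1; lra.
apply/ler_addgt0Pr => e e0.
(* The weights are at least 1 and the weighted sums stay below [S], so the radii cannot remain above
   a fixed threshold on all levels. *)
have [m me] : exists m, L * delta (j0 + m)%N `^ alpha <= e.
  apply: contrapT => /forallNP none.
  have big m : m%:R * e <= L * S.
    apply: (@le_trans _ _ (L * \sum_(j < j0 + m) 2 `^ (j%:R / 2) * delta j `^ alpha)).
      rewrite big_split_ord/= mulrDr.
      have s0 : 0 <= L * \sum_(j < j0) 2 `^ (j%:R / 2) * delta j `^ alpha.
        by rewrite mulr_ge0// sumr_ge0// => j _; rewrite mulr_ge0.
      suff : m%:R * e <= L * \sum_(j < m) 2 `^ ((j0 + j)%N%:R / 2) * delta (j0 + j)%N `^ alpha by lra.
      rewrite mulr_sumr mulr_natl -[m in leLHS]card_ord -sumr_const ler_sum// => j _.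
      have /negP := none j; rewrite -ltNge => /ltW/le_trans; apply.
      rewrite ler_wpM2l// ler_peMl// -[leLHS](powRr0 2) ler_powR ?ler1n// divr_ge0//.
    by rewrite ler_wpM2l.
  have := big (Num.truncn (L * S / e)).+1; rewrite -ler_pdivlMr//.
  by rewrite leNgt truncnS_gt.
have := ler_distD (g (v (j0 + m)%N)) (g x) (g x0).
have := hold _ _ Mx (uM (j0 + m)%N (i (j0 + m)%N)); rewrite -/(v _).
have := ler_wpM2l L0 (xv (j0 + m)%N); have := step m.
have := ler_wpM2l b0 (sumS (j0 + m)%N); have := ler_wpM2l b0 (sumS (j0 + m).+1).
rewrite mulrDr; lra.
Qed.

End chaining_bound.

Section admissible_net.
Local Open Scope card_scope.
Variables (R : realType) (d : nat) (nrm : 'rV[R]_d -> R).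
Hypothesis nrmP : is_norm nrm.

Lemma nrm_le_diam (M : set 'rV[R]_d) x y : M x -> M y -> ((nrm (x - y))%:E <= diam nrm M)%E.
Proof. by move=> Mx My; apply: ereal_sup_ubound; exists x => //; exists y. Qed.

Lemma diam_ge0 (M : set 'rV[R]_d) x : M x -> (0 <= diam nrm M)%E.
Proof. by move=> Mx; have := nrm_le_diam Mx Mx; rewrite subrr is_norm0. Qed.

(** Of a partition, chaining needs only one point per cell and the largest diameter. The last clause
    holds because level 0 has a single cell; it later gives that the chaining sum dominates the
    power of the diameter. *)
Lemma admissible_net (alpha S : R) (M : set 'rV[R]_d) (x0 : 'rV[R]_d)
    (A : nat -> set (set 'rV[R]_d)) :
  0 < alpha -> M x0 -> admissible M A ->
  (\sum_(0 <= j <oo) (2 `^ (j%:R / 2))%:E * diam_partition nrm (A j) `^ alpha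
    <= S%:E)%E ->
  exists u delta, [/\ forall j i, M (u j i),
    forall j x, M x -> exists i, (i < 2 ^ (2 ^ j))%N /\ nrm (x - u j i) <= delta j,
    forall n, \sum_(j < n) 2 `^ (j%:R / 2) * delta j `^ alpha <= S
    & forall x y, M x -> M y -> nrm (x - y) <= delta 0%N].
Proof.
move=> alpha0 Mx0 [Apart A0 Acard] AS.
have alpha_neq0 : alpha != 0 by rewrite gt_eqF.
pose dp j := diam_partition nrm (A j).
have cell j x : M x -> exists2 B, A j B & B x.
  by have [+ _ _] := Apart j; rewrite /cover => <- [B AB Bx]; exists B.
have cellM j B x : A j B -> B x -> M x.
  by have [<- _ _] := Apart j => AB Bx; exists B.
have dp_cell j B : A j B -> (diam nrm B <= dp j)%E.
  by move=> AB; apply: ereal_sup_ubound; exists B.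
have dp_ge0 j : (0 <= dp j)%E.
  have [B AB Bx] := cell j _ Mx0.
  exact: le_trans (diam_ge0 Bx) (dp_cell _ _ AB).
have term_ge0 j : (0 <= (2 `^ (j%:R / 2))%:E * dp j `^ alpha)%E.
  by rewrite mule_ge0 ?lee_fin ?powR_ge0// poweR_ge0.
have partial n : (\sum_(j < n) (2 `^ (j%:R / 2))%:E * dp j `^ alpha <= S%:E)%E.
  apply: le_trans AS; rewrite -(big_mkord xpredT (fun j => (2 `^ (j%:R / 2))%:E * dp j `^ alpha)%E).
  by apply: nneseries_lim_ge => j _ _; exact: term_ge0.
(* An infinite diameter would make a partial sum infinite, as the weight is positive and all terms
   are nonnegative. *)
have dp_fin j : dp j \is a fin_num.
  rewrite ge0_fin_numE// ltNge leye_eq; apply/negP => /eqP dpoo.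
  have := partial j.+1; rewrite big_ord_recr/= dpoo poweRyr// gt0_muley; last first.
    by rewrite lte_fin powR_gt0.
  rewrite addey ?leye_eq//.
  by rewrite -ltNye (lt_le_trans ltNy0)// sume_ge0.
pose delta j := fine (dp j).
have cell_delta j B x y : A j B -> B x -> B y -> nrm (x - y) <= delta j.
  move=> AB Bx By; rewrite -lee_fin fineK//.
  exact: le_trans (nrm_le_diam Bx By) (dp_cell _ _ AB).
(* Level 0 has one cell while the uniform count [2 ^ (2 ^ 0)] allows two. *)
have Acard_le j : A j #<= `I_(2 ^ (2 ^ j)).
  case: j => [|j]; last exact: Acard.
  apply: (@card_le_trans _ _ _ `I_1); first by have [] := (card_eqPle _ _).1 A0.
  by apply: subset_card_le => i /=; rewrite ltnS leqn0 => /eqP ->.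
have /choice[u uP] j : exists v : nat -> 'rV[R]_d, (forall i, M (v i)) /\
    forall x, M x -> exists i, (i < 2 ^ (2 ^ j))%N /\ nrm (x - v i) <= delta j.
  have /pcard_surjP[g gsurj] := Acard_le j.
  (* An index that names no cell receives the default point [x0], which keeps the whole sequence in
     [M]. *)
  have /choice[v vP] i : exists y, M y /\ (A j (g i) -> g i y).
    have [Agi|nAgi] := pselect (A j (g i)); last by exists x0.
    have [_ _ nonempty] := Apart j; have [y gy] := nonempty _ Agi.
    by exists y; split=> //; exact: cellM Agi gy.
  exists v; split=> [i|x Mx]; first exact: (vP i).1.
  have [B AB Bx] := cell j _ Mx; have [i ilt giB] := gsurj _ AB.
  exists i; split=> //; apply: (cell_delta _ B) => //.
  by move: AB; rewrite -giB; exact: (vP i).2.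
exists u, delta; split.
- by move=> j i; exact: (uP j).1.
- by move=> j x; exact: (uP j).2.
- move=> n; rewrite -lee_fin -sumEFin; apply: le_trans (partial n).
  by apply: lee_sum => j _; rewrite EFinM -(poweR_EFin (delta j) alpha) /delta fineK.
move=> x y Mx My; have [B AB Bx] := cell 0%N _ Mx; have [B' AB' By] := cell 0%N _ My.
suff BB' : B = B' by apply: (cell_delta 0%N B) => //; rewrite BB'.
have /pcard_surjP[g gsurj] : A 0%N #<= `I_1 by have [] := (card_eqPle _ _).1 A0.
have := gsurj _ AB; have := gsurj _ AB'.
by move=> [i +] <- [i' +] <-; rewrite /= !ltnS !leqn0 => /eqP -> /eqP ->.
Qed.
End admissible_net.

Lemma natr_exp_le_expR (R : realType) (n : nat) : (2 ^ n)%N%:R <= expR n%:R :> R.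
Proof.
rewrite -[n%:R]mulr1 expRM_natl natrX lerXn2r ?nnegrE ?expR_ge0//.
by rewrite (le_trans _ (expR_ge1Dx 1))//; lra.
Qed.

Lemma powR2_half (R : realType) (j : nat) : 2 `^ (j%:R / 2) = Num.sqrt (2 ^+ j) :> R.
Proof. by rewrite powRrM powR_mulrn// powR12_sqrt// exprn_ge0. Qed.

(* Chaining from level [0] would cost [sqrt t] times the whole chaining sum;
   starting at this level costs only [sqrt t] times the diameter. *)
Lemma exists_dyadic_level (R : realType) (t : R) : 0 <= t ->
  exists j, 2 ^+ j <= 1 + t /\ t <= 2 * 2 ^+ j.
Proof.
move=> t0; have ex : exists n, t < 2 ^+ n.
  exists (Num.truncn t).+1; apply: lt_le_trans (truncnS_gt t) _.
  by rewrite -natrX ler_nat ltnW// ltn_expl.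
case: (ex_minnP ex) => -[|m] tm least.
  by exists 0%N; move: tm; rewrite expr0; lra.
exists m; move: tm; rewrite exprS => tm; split; last exact: ltW.
have [tm'|] := ltP t (2 ^+ m); last by lra.
by have := least _ tm'; rewrite ltnn.
Qed.

Section chaining_probability.
Context (R : realType) (dO : measure_display) (Omega : measurableType dO).
Variables (PO : probability Omega R) (d : nat) (nrm : 'rV[R]_d -> R).
Hypothesis nrmP : is_norm nrm.
Variables (alpha : R) (M : set 'rV[R]_d) (x0 : 'rV[R]_d).
Hypotheses (alpha0 : 0 < alpha) (alpha1 : alpha <= 1) (Mx0 : M x0).
Variables (u : nat -> nat -> 'rV[R]_d) (delta : nat -> R) (S : R).
Hypothesis uM : forall j i, M (u j i).
Hypothesis net : forall j x, M x ->
  exists i, (i < 2 ^ (2 ^ j))%N /\ nrm (x - u j i) <= delta j.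
Hypothesis sumS : forall n,
  \sum_(j < n) 2 `^ (j%:R / 2) * delta j `^ alpha <= S.
Variables (g : Omega -> 'rV[R]_d -> R) (G : set Omega) (s t Dm : R).
Hypotheses (s0 : 0 <= s) (t0 : 0 <= t) (mG : measurable G).
Hypothesis mg : forall x, M x -> measurable_fun setT (g ^~ x).
Hypothesis hold : forall w, exists2 L, 0 <= L & forall x y, M x -> M y ->
  `|g w x - g w y| <= L * nrm (x - y) `^ alpha.
Hypothesis tail : forall x y tau, M x -> M y -> 0 <= tau ->
  (PO (G `&` [set w | (tau * s * nrm (x - y) `^ alpha < `|g w x - g w y|)%R]) <=
    (2 * expR (- (3 * tau ^+ 2 / 28)))%:E)%E.
Hypothesis DmM : forall x y, M x -> M y -> nrm (x - y) <= Dm.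
Hypothesis DmS : Dm `^ alpha <= S.

(* [11] makes the exponent [3 * tau j ^+ 2 / 28] exceed [12 * 2 ^+ j + t], while
   there are at most [expR (3 * 2 ^+ j)] links between the levels [j] and [j + 1]. *)
Let tau j : R := 11 * Num.sqrt (2 ^+ j + t).
Let E x y a := G `&` [set w | a * s * nrm (x - y) `^ alpha < `|g w x - g w y|].

Let tau0 j : 0 <= tau j. Proof. by rewrite mulr_ge0// sqrtr_ge0. Qed.

Let mE x y a : M x -> M y -> measurable (E x y a).
Proof.
move=> Mx My; apply: measurableI => //; apply: measurable_lt => //.
apply: measurableT_comp => //; apply: measurable_funB; exact: mg.
Qed.

(** After counting the links, [expR (- (9 * 2 ^+ j))] is left over. It absorbs [2 ^ (j + 5)], the
    product of the 2 of the two-sided tail, the 8 and the weight [2 ^ j.+1] that makes the levels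
    summable. *)
Let level_bound j :
  (2 ^ (2 ^ j) * 2 ^ (2 ^ j.+1))%N%:R * (2 * expR (- (3 * tau j ^+ 2 / 28))) <=
  (expR (- t) / 8) / (2 ^ j.+1)%:R.
Proof.
have p2 : 0 <= 2 ^+ j :> R by rewrite exprn_ge0.
have -> : (2 ^ (2 ^ j) * 2 ^ (2 ^ j.+1) = 2 ^ (2 ^ j * 3))%N.
  by rewrite -expnD expnS; congr (2 ^ _)%N; lia.
have n_le : (2 ^ (2 ^ j * 3))%N%:R <= expR (3 * 2 ^+ j) :> R.
  by rewrite (le_trans (natr_exp_le_expR _ _))// ler_expR natrM natrX mulrC.
have tau2 : 3 * tau j ^+ 2 / 28 = 363 / 28 * (2 ^+ j + t).
  by rewrite exprMn sqr_sqrtr ?addr_ge0//; field.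
have q_le : expR (- (3 * tau j ^+ 2 / 28)) <= expR (- (12 * 2 ^+ j)) * expR (- t).
  rewrite -expRD ler_expR tau2; move: (2 ^+ j) p2 => P p2.
  have aux (P' t' : R) : 0 <= t' -> 0 <= P' -> - (363 / 28 * (P' + t')) <= - (12 * P') - t' by lra.
  exact: aux.
have j5 : (2 ^ (j + 5))%N%:R * expR (- (9 * 2 ^+ j)) <= 1 :> R.
  rewrite expRN ler_pdivrMr ?expR_gt0// mul1r (le_trans (natr_exp_le_expR _ _))//.
  have -> : 9 * 2 ^+ j = (9 * 2 ^ j)%N%:R :> R by rewrite natrM natrX.
  by rewrite ler_expR ler_nat; have := ltn_expl j (isT : 1 < 2)%N; lia.
have et := expR_gt0 (- t).
rewrite ler_pdivlMr ?ltr0n ?expn_gt0//.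
apply: (@le_trans _ _ (expR (3 * 2 ^+ j) *
    (2 * (expR (- (12 * 2 ^+ j)) * expR (- t))) * (2 ^ j.+1)%:R)).
  rewrite ler_wpM2r// ler_pM ?mulr_ge0 ?expR_ge0// ler_wpM2l//.
have -> : expR (3 * 2 ^+ j) * (2 * (expR (- (12 * 2 ^+ j)) * expR (- t))) * (2 ^ j.+1)%:R =
    expR (- t) / 8 * ((2 ^ (j + 5))%N%:R * expR (- (9 * 2 ^+ j))).
  have -> : expR (- (9 * 2 ^+ j)) = expR (3 * 2 ^+ j) * expR (- (12 * 2 ^+ j)) :> R.
    by rewrite -expRD; congr expR; lra.
  by rewrite !natrX exprD exprS; field.
by rewrite -[leRHS]mulr1 ler_wpM2l// divr_ge0// ltW.
Qed.

(** The starting points and all later links each fail with probability at most [expR (- t) / 8].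
    Outside these events the start costs [11 + 16 * Num.sqrt t] times the power of the diameter and
    the links cost [2 * 20 * S]; bounding that power by [S] in the term with 11 gives 51. *)
Lemma chaining_event : exists B, [/\ measurable B,
  (PO B <= (expR (- t) / 4)%:E)%E
  & forall w, G w -> ~ B w -> forall x, M x ->
    `|g w x - g w x0| <= s * (51 * S + 16 * Num.sqrt t * Dm `^ alpha)].
Proof.
have [j0 [j0t tj0]] := exists_dyadic_level t0.
have Da0 : 0 <= Dm `^ alpha by exact: powR_ge0.
have S0 : 0 <= S by exact: le_trans DmS.
pose B0 := \big[setU/set0]_(i < 2 ^ (2 ^ j0)) E (u j0 i) x0 (tau j0).
pose B1 j := \big[setU/set0]_(p : 'I_(2 ^ (2 ^ j)) * 'I_(2 ^ (2 ^ j.+1)))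
  E (u j.+1 p.2) (u j p.1) (tau j).
have mB0 : measurable B0 by apply: bigsetU_measurable => i _; exact: mE.
have mB1 j : measurable (B1 j) by apply: bigsetU_measurable => p _; exact: mE.
have PB1 j : (PO (B1 j) <= ((expR (- t) / 8) / (2 ^ j.+1)%:R)%:E)%E.
  apply: (le_trans (finite_union_bound _ _)) => [p|]; first exact: mE.
  apply: (@le_trans _ _ (\sum_(p : 'I_(2 ^ (2 ^ j)) * 'I_(2 ^ (2 ^ j.+1)))
      (2 * expR (- (3 * tau j ^+ 2 / 28)))%:E)%E).
    by apply: lee_sum => p _; exact: tail.
  rewrite sumEFin sumr_const card_prod !card_ord lee_fin -[leLHS]mulr_natl.
  exact: level_bound.
have PB0 : (PO B0 <= (expR (- t) / 8)%:E)%E.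
  apply: (le_trans (finite_union_bound _ _)) => [p|]; first exact: mE.
  apply: (@le_trans _ _ (\sum_(p : 'I_(2 ^ (2 ^ j0)))
      (2 * expR (- (3 * tau j0 ^+ 2 / 28)))%:E)%E).
    by apply: lee_sum => p _; exact: tail.
  rewrite sumEFin sumr_const card_ord lee_fin -[leLHS]mulr_natl.
  apply: (@le_trans _ _ ((expR (- t) / 8) / (2 ^ j0.+1)%:R)).
    apply: le_trans (level_bound j0).
    rewrite ler_wpM2r ?mulr_ge0 ?expR_ge0// ler_nat leq_pmulr// expn_gt0//.
  rewrite ler_pdivrMr ?ltr0n ?expn_gt0// ler_peMr ?divr_ge0 ?expR_ge0//.
  by rewrite ler1n expn_gt0.
exists (B0 `|` \bigcup_m B1 (j0 + m)%N); split.
- by apply: measurableU => //; exact: bigcup_measurable.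
- apply: (le_trans (measureU2 _ _ _)) => //; first exact: bigcup_measurable.
  have -> : expR (- t) / 4 = expR (- t) / 8 + expR (- t) / 8 by field.
  rewrite EFinD; apply: leeD => //.
  apply: le_trans (generalized_Boole_inequality _ _ _) _ => //.
    exact: bigcup_measurable.
  apply: le_trans (epsilon_trick0 xpredT (_ : 0 <= expR (- t) / 8)); last first.
    by rewrite divr_ge0 ?expR_ge0.
  apply: lee_nneseries => // m _; apply: le_trans (PB1 _) _.
  rewrite lee_fin ler_wpM2l ?divr_ge0 ?expR_ge0//.
  by rewrite lef_pV2 ?posrE ?ltr0n ?expn_gt0// ler_nat leq_exp2l// ltnS leq_addl.
move=> w Gw nB x Mx; have [L L0 gL] := hold w.
have nE0 i : (i < 2 ^ (2 ^ j0))%N ->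
    `|g w (u j0 i) - g w x0| <= tau j0 * s * nrm (u j0 i - x0) `^ alpha.
  move=> ilt; rewrite leNgt; apply/negP => Ew; apply: nB; left.
  by rewrite /B0 -bigcup_pred; exists (Ordinal ilt).
have nE1 j i i' : (j0 <= j)%N -> (i < 2 ^ (2 ^ j))%N -> (i' < 2 ^ (2 ^ j.+1))%N ->
    `|g w (u j.+1 i') - g w (u j i)| <= tau j * s * nrm (u j.+1 i' - u j i) `^ alpha.
  move=> jj ilt ilt'; rewrite leNgt; apply/negP => Ew; apply: nB; right.
  exists (j - j0)%N => //; rewrite subnKC// /B1 -bigcup_pred.
  by exists (Ordinal ilt, Ordinal ilt').
have st0 : 0 <= Num.sqrt t by exact: sqrtr_ge0.
(* From [2 ^+ j0 <= 1 + t]: the square of the left side is at most [121 + 242 * t], and 256 is the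
   square of 16. *)
have tau_first : tau j0 <= 11 + 16 * Num.sqrt t.
  rewrite -(@ler_pXn2r _ 2) ?nnegrE ?addr_ge0 ?mulr_ge0 ?sqrtr_ge0//.
  rewrite exprMn sqr_sqrtr ?addr_ge0 ?exprn_ge0//.
  have -> : (11 + 16 * Num.sqrt t) ^+ 2 = 121 + 352 * Num.sqrt t + 256 * Num.sqrt t ^+ 2 by ring.
  rewrite sqr_sqrtr//; have aux (P r t' : R) : 0 <= t' -> 0 <= r ->
      P <= 1 + t' -> 11 ^+ 2 * (P + t') <= 121 + 352 * r + 256 * t' by lra.
  exact: aux.
(* From level [j0] on, [t <= 2 * 2 ^+ j], so the square is at most [363 * 2 ^+ j], below
   [400 * 2 ^+ j]. *)
have tau_link j : (j0 <= j)%N -> tau j <= 20 * 2 `^ (j%:R / 2).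
  move=> jj; rewrite powR2_half -(@ler_pXn2r _ 2) ?nnegrE ?mulr_ge0 ?sqrtr_ge0//.
  rewrite !exprMn !sqr_sqrtr ?addr_ge0 ?exprn_ge0//.
  have : 2 ^+ j0 <= 2 ^+ j :> R by rewrite ler_weXn2l// ler1n.
  have aux (P Q t' : R) : t' <= 2 * P -> P <= Q -> 0 <= Q ->
      11 ^+ 2 * (Q + t') <= 20 ^+ 2 * Q by lra.
  by move=> PQ; apply: (aux _ _ _ tj0 PQ); rewrite exprn_ge0.
have := chaining_bound nrmP alpha0 alpha1 uM net sumS (j0 := j0) (g := g w) (x0 := x0)
  (a := (11 + 16 * Num.sqrt t) * s * Dm `^ alpha) (b := 20 * s) _ L0 _ _ gL Mx.
rewrite mulr_ge0// => /(_ isT) bound; apply: le_trans (bound _ _) _.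
- move=> i ilt; apply: le_trans (nE0 i ilt) _.
  rewrite ler_pM ?mulr_ge0 ?powR_ge0// ?ler_wpM2r//.
  by rewrite ge0_ler_powR ?nnegrE ?(ltW alpha0)// ?(is_norm_ge0 nrmP)// ?DmM//
    (le_trans _ (DmM Mx0 Mx0))// (is_norm_ge0 nrmP).
- move=> j i i' jj ilt ilt'; apply: le_trans (nE1 j i i' jj ilt ilt') _.
  rewrite ler_wpM2r ?powR_ge0// [leRHS]mulrAC ler_wpM2r//.
  exact: tau_link.
have := ler_wpM2l s0 DmS; lra.
Qed.
End chaining_probability.

(** * Measurability *)

Section measurability.
Context (R : realType) (d : nat).

(** The sequence has to lie in [A], where the continuity assumptions hold. For each rational centre
    and radius [1 / (k + 1)] a point of [A] in that ball is chosen when there is one, and [a]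
    otherwise. *)
Lemma dense_sequence (A : set 'rV[R]_d) : A !=set0 ->
  exists u : nat -> 'rV[R]_d, (forall n, A (u n)) /\
    forall x, A x -> forall e, 0 < e -> exists n, ball x e (u n).
Proof.
move=> [a Aa].
have /choice[v vP] (c : 'rV[rat]_d * nat) : exists y, A y /\
    forall z, A z -> ball (map_mx ratr c.1 : 'rV[R]_d) (c.2.+1%:R^-1) z ->
      ball (map_mx ratr c.1 : 'rV[R]_d) (c.2.+1%:R^-1) y.
  have [[z [Az bz]]|none] := pselect (exists z, A z /\
      ball (map_mx ratr c.1 : 'rV[R]_d) (c.2.+1%:R^-1) z); first by exists z.
  by exists a; split=> // z Az bz; exfalso; apply: none; exists z.
exists (fun n => if unpickle n is Some c then v c else a); split=> [n|x Ax e e0].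
  by case: unpickle => [c|] //; exact: (vP c).1.
pose n := Num.truncn (2 / e); pose r : R := n.+1%:R^-1.
have r0 : 0 < r by rewrite invr_gt0 ltr0n.
have re : r + r <= e.
  have : 2 / e < n.+1%:R by exact: truncnS_gt.
  rewrite ltr_pdivrMr// => h; rewrite -mulr2n -mulr_natl ler_pdivrMr ?ltr0n//.
  by rewrite mulrC ltW.
have /choice[q qP] (i : 'I_d) : exists q : rat, ball (ratr q : R) r (x ord0 i).
  have [|q] := @rat_in_itvoo _ (x ord0 i - r) (x ord0 i + r).
    by rewrite ltrBlDr -addrA ltrDl addr_gt0.
  rewrite in_itv/= => /andP[q1 q2]; exists q; rewrite /ball/= ltr_distl; apply/andP; split; lra.
pose c := (\row_i q i, n).
have bx : ball (map_mx ratr c.1 : 'rV[R]_d) r x.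
  by split=> // i j; rewrite (ord1 i) !mxE.
exists (pickle c); rewrite pickleK; apply: (le_ball re).
by apply: ball_triangle (ball_sym bx) _; exact: (vP c).2 Ax bx.
Qed.

Lemma dense_sequence_lt (A : set 'rV[R]_d) (u : nat -> 'rV[R]_d) (g : 'rV[R]_d -> R) c x :
  (forall x, A x -> forall e, 0 < e -> exists n, ball x e (u n)) ->
  (forall n, A (u n)) -> {within A, continuous g} -> A x -> g x < c ->
  exists n, g (u n) < c.
Proof.
move=> ud uA /subspace_continuousP gc Ax gx.
have /nbhs_ballP[e /= e0 be] := gc x Ax _ (lt_nbhsl gx).
have [n bn] := ud x Ax e e0; exists n; exact: be bn (uA n).
Qed.

Context (dO : measure_display) (Omega : measurableType dO).

(** A strict inequality is a relatively open condition on [x], so a countable dense subset of [K]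
    detects it. Non-strict inequalities are reduced to this one by compactness. *)
Lemma measurable_exists_lt (K : set 'rV[R]_d) (g : Omega -> 'rV[R]_d -> R) (b : Omega -> R) :
  (forall w, {within K, continuous (g w)}) ->
  (forall x, K x -> measurable_fun setT (g ^~ x)) ->
  measurable_fun setT b ->
  measurable [set w | exists2 x, K x & g w x < b w].
Proof.
move=> gc mg mb; have [->|/set0P K0] := eqVneq K set0.
  by rewrite [X in measurable X](_ : _ = set0)//; apply/seteqP; split=> w //= [].
have [u [uK ud]] := dense_sequence K0.
rewrite [X in measurable X](_ : _ = \bigcup_n [set w | g w (u n) < b w]).
  by apply: bigcup_measurable => n _; apply: measurable_lt => //; exact: mg.
apply/seteqP; split=> w /= => [[x Kx gx]|[n _ gn]]; last by exists (u n).
by have [n gn] := dense_sequence_lt ud uK (gc w) Kx gx; exists n.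
Qed.

Lemma opt_valueE (Y : set 'rV[R]_d) (g : 'rV[R]_d -> R) x :
  minimizer Y g x -> opt_value Y g = g x.
Proof.
move=> [Yx gx]; apply/eqP; rewrite eq_le; apply/andP; split.
  by apply: ge_inf; [exists (g x) => _ [y Yy <-]; exact: gx | exists x].
by apply: lb_le_inf; [exists (g x); exists x | move=> _ [y Yy <-]; exact: gx].
Qed.

Variables (Y : set 'rV[R]_d) (g : Omega -> 'rV[R]_d -> R).
Hypothesis gc : forall w, {within Y, continuous (g w)}.
Hypothesis mg : forall x, Y x -> measurable_fun setT (g ^~ x).
Hypothesis gmin : forall w, exists x, minimizer Y (g w) x.

Lemma measurable_opt_value : measurable_fun setT (fun w => opt_value Y (g w)).
Proof.
move=> mD; apply: (measurability _ (RGenInftyO.measurableE R)) => //.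
move=> _ [_ [a ->] <-]; rewrite setTI.
rewrite [X in measurable X](_ : _ = [set w | exists2 x, Y x & g w x < a]).
  exact: measurable_exists_lt.
apply/seteqP; split=> w /=; have [x xmin] := gmin w; rewrite in_itv/= (opt_valueE xmin).
  by exists x => //; case: xmin.
by case=> y Yy; apply: le_lt_trans; case: xmin => _; exact.
Qed.

Hypothesis closedY : closed Y.

Lemma compact_superlevel (f : 'rV[R]_d -> R) (a : R) (n : nat) :
  {within Y, continuous f} ->
  compact [set x | [/\ Y x, forall i, `|x ord0 i| <= n%:R & a <= f x]].
Proof.
move=> fc; set S := (X in compact X).
pose box : set 'rV[R]_d := [set x | forall i : 'I_d, `[- n%:R, n%:R]%classic (x ord0 i)].
have cbox : compact box.
  have := @rV_compact R d (fun=> `[- n%:R, n%:R]%classic); apply=> i.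
  exact: segment_compact.
have boxP x : box x <-> forall i, `|x ord0 i| <= n%:R.
  by split=> xn i; have := xn i; rewrite /= in_itv/= -ler_norml.
apply: (subclosed_compact _ cbox); last by move=> x [_ /boxP].
have -> : S = box `&` [set x | Y x /\ a <= f x].
  by apply/seteqP; split=> x /= => [[Yx /boxP bx fx]|[/boxP bx [Yx fx]]].
apply: closedI; first by apply: compact_closed => //; exact: norm_hausdorff.
have /continuous_closedP/(_ _ (@closed_ge _ a)) := fc.
move=> /closed_subspaceP[V cV VY].
rewrite [X in closed X](_ : _ = V `&` Y); first exact: closedI.
by rewrite VY; apply/seteqP; split=> x /= [].
Qed.

(** The complement says that some near-minimizer of [g w] has [f x > a]. Such a point lies in some
    compact [K n], where [f] exceeds [a] by a fixed gap; on [K n] the minimum is attained, so a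
    non-strict bound on [g w] is the same as all the strict bounds relaxed by [1 / (m + 1)]. *)
Lemma measurable_near_opt_sub (f : 'rV[R]_d -> R) (e a : R) :
  {within Y, continuous f} ->
  measurable [set w | forall x, Y x -> g w x <= opt_value Y (g w) + e -> f x <= a].
Proof.
move=> fc.
pose K n := [set x | [/\ Y x, forall i, `|x ord0 i| <= n%:R & a + n.+1%:R^-1 <= f x]].
have KY n : K n `<=` Y by move=> x [].
rewrite [X in measurable X](_ : _ = ~` \bigcup_n \bigcap_m
    [set w | exists2 x, K n x & g w x < opt_value Y (g w) + e + m.+1%:R^-1]).
  apply: measurableC; apply: bigcup_measurable => n _; apply: bigcap_measurableType => m _.
  apply: measurable_exists_lt => [w|x [Yx _ _]|]; last 2 first.
  - exact: mg.
  - do 2 apply: measurable_funD => //; exact: measurable_opt_value.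
  exact: continuous_subspaceW (KY n) (@gc w).
apply/seteqP; split=> w /=.
  move=> sub [n _ ex]; have [|c cK cmin] := @compact_EVT_min _ R (g w) (K n) _
      (compact_superlevel (n := n) fc) (continuous_subspaceW (KY n) (@gc w)).
    by have [x Kx _] := ex 0%N I; exists x.
  move: cK; rewrite inE => cK; have [Yc _ fcn] := cK.
  have : g w c <= opt_value Y (g w) + e.
    apply/ler_addgt0Pr => r r0.
    have [x Kx gx] := ex (Num.truncn r^-1) I.
    apply: (le_trans (cmin x (mem_set Kx))); apply: (le_trans (ltW gx)).
    rewrite lerD2l -[leRHS]invrK lef_pV2 ?posrE ?invr_gt0 ?ltr0n//.
    by rewrite ltW// truncnS_gt.
  move=> /(sub c Yc); apply/negP; rewrite -ltNge; apply: lt_le_trans fcn.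
  by rewrite ltrDl invr_gt0 ltr0n.
move=> none x Yx gx; rewrite leNgt; apply/negP => fx; apply: none.
have fa0 : 0 < f x - a by rewrite subr_gt0.
(* Large enough both for the gap [f x - a] and for the largest coordinate of [x]. *)
pose n := maxn (Num.truncn (f x - a)^-1) (\max_i Num.truncn `|x ord0 i|).+1.
exists n => // m _; exists x; last first.
  by rewrite (le_lt_trans gx)// ltrDl invr_gt0 ltr0n.
split=> // [i|].
  apply: (le_trans (ltW (truncnS_gt _))); rewrite ler_nat leq_max ltnS; apply/orP; right.
  exact: (leq_bigmax (F := fun i => Num.truncn `|x ord0 i|)).
have : n.+1%:R^-1 <= f x - a; last by rewrite lerBrDl.
rewrite -[leRHS]invrK lef_pV2 ?posrE ?invr_gt0 ?ltr0n//.
apply: (le_trans (ltW (truncnS_gt _))).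
by rewrite ler_nat ltnS leq_maxl.
Qed.

End measurability.

(** * Deviations of the sample average *)

Section sample_deviations.
Context (R : realType) (dX dO : measure_display).
Context (Xi : measurableType dX) (Omega : measurableType dO).
Variables (PX : probability Xi R) (PO : probability Omega R).
Variables (N : nat) (xi : 'I_N -> {RV PO >-> Xi}).
Hypotheses (N0 : (0 < N)%N) (iid : iid_sample PX xi).

Lemma self_normalized_tail_abs (X : Xi -> R) (u v W : R) :
  0 <= u -> 0 < W + 2 * N%:R * v ->
  PX.-integrable setT (EFin \o X) -> (\int[PX]_z (X z)%:E = 0)%E ->
  (\int[PX]_z (X z ^+ 2)%:E <= v%:E)%E ->
  (PO [set w | (u < `|\sum_k X (xi k w)|)%R /\ (\sum_k X (xi k w) ^+ 2 <= W)%R] <=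
    (2 * expR (- (3 * u ^+ 2 / (2 * (W + 2 * N%:R * v)))))%:E)%E.
Proof.
move=> u0 V0 iX X0 Xv.
have mX : measurable_fun setT X by apply/measurable_EFinP; case/integrableP : iX.
have mXk k : measurable_fun setT (fun w => X (xi k w)).
  by apply: (measurableT_comp mX); exact: measurable_funP.
have mS : measurable_fun setT (fun w => \sum_k X (xi k w)) by exact: measurable_sum.
have mQ : measurable [set w | \sum_k X (xi k w) ^+ 2 <= W].
  by apply: measurable_le => //; apply: measurable_sum => k; exact: measurable_funX.
pose Ep := [set w | u < \sum_k X (xi k w) /\ \sum_k X (xi k w) ^+ 2 <= W].
pose En := [set w | u < \sum_k - X (xi k w) /\ \sum_k (- X (xi k w)) ^+ 2 <= W].
have sumN w : \sum_k - X (xi k w) = - \sum_k X (xi k w) by rewrite sumrN.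
have sqN w : \sum_k (- X (xi k w)) ^+ 2 = \sum_k X (xi k w) ^+ 2.
  by apply: eq_bigr => k _; rewrite sqrrN.
have mEp : measurable Ep by apply: measurableI => //; exact: measurable_lt.
have mEn : measurable En.
  rewrite /En; under eq_set do rewrite sumN sqN.
  by apply: measurableI => //; apply: measurable_lt => //; exact: measurableT_comp.
have Pp : (PO Ep <= (expR (- (3 * u ^+ 2 / (2 * (W + 2 * N%:R * v)))))%:E)%E.
  exact: (self_normalized_tail iid u0 V0 iX X0 Xv).
have Pn : (PO En <= (expR (- (3 * u ^+ 2 / (2 * (W + 2 * N%:R * v)))))%:E)%E.
  apply: (self_normalized_tail iid (X := fun z => - X z) u0 V0).
  - rewrite (_ : EFin \o _ = \- (EFin \o X))%E; last exact/funext.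
    exact: integrableN.
  - under eq_integral do rewrite EFinN.
    by rewrite integralN ?X0 ?oppe0//=; apply: integrable_add_def.
  - by under eq_integral do rewrite sqrrN.
apply: (@le_trans _ _ (PO (Ep `|` En))).
  apply: le_measure; rewrite ?inE//.
  - by apply: measurableI => //; apply: measurable_lt => //; exact: measurableT_comp.
  - exact: measurableU.
  move=> w /= [uX XW]; have [S0|S0] := leP 0 (\sum_k X (xi k w)).
    by left; split=> //; rewrite -(ger0_norm S0).
  by right; rewrite /En/= sumN sqN -(ltr0_norm S0).
apply: (le_trans (measureU2 _ _ _)) => //.
by rewrite mulr2n mulrDl !mul1r EFinD; apply: leeD.
Qed.

Variables (d : nat) (F : 'rV[R]_d -> Xi -> R).
Let f := mean_obj PX F.

Lemma centered_sum x w :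
  \sum_k (F x (xi k w) - f x) = N%:R * (saa_obj xi F w x - f x).
Proof.
rewrite sumrB sumr_const card_ord /saa_obj /emp_mean mulrBr mulrC divfK//.
  by rewrite mulr_natl.
by rewrite pnatr_eq0 -lt0n.
Qed.

Lemma centered_integrable x : PX.-integrable setT (EFin \o F x) ->
  PX.-integrable setT (EFin \o (fun z => F x z - f x)).
Proof.
move=> iF; rewrite (_ : EFin \o _ = (EFin \o F x) \- (cst (f x)%:E))%E; last exact/funext.
by apply: integrableB => //; exact: finite_measure_integrable_cst.
Qed.

Lemma centered_integral0 x : PX.-integrable setT (EFin \o F x) ->
  (\int[PX]_z (F x z - f x)%:E = 0)%E.
Proof.
move=> iF; under eq_integral do rewrite EFinB.
rewrite integralB//; last exact: finite_measure_integrable_cst.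
rewrite integral_cst//= probability_setT mule1 /f /mean_obj /Rintegral fineK ?subee//.
  exact: integrable_fin_num.
exact: integrable_fin_num.
Qed.

Lemma measurable_saa x : PX.-integrable setT (EFin \o F x) ->
  measurable_fun setT (fun w => saa_obj xi F w x).
Proof.
move=> /integrableP[/measurable_EFinP mF _]; apply: measurable_funM => //.
by apply: measurable_sum => k; apply: (measurableT_comp mF); exact: measurable_funP.
Qed.

Lemma measurable_emp_mean_le (h : Xi -> R) (c : R) : measurable_fun setT h ->
  measurable [set w | emp_mean xi h w <= c].
Proof.
move=> mh; apply: measurable_le => //; apply: measurable_funM => //.
by apply: measurable_sum => k; apply: (measurableT_comp mh); exact: measurable_funP.
Qed.

Lemma center_deviation (x : 'rV[R]_d) (ss q : R) :
  0 < ss -> 0 <= q -> PX.-integrable setT (EFin \o F x) ->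
  (\int[PX]_z ((F x z - f x) ^+ 2)%:E <= (ss ^+ 2)%:E)%E ->
  (PO ([set w | (emp_mean xi (fun z => (F x z - f x) ^+ 2) w <= 2 * ss ^+ 2)%R] `&`
       [set w | (ss * Num.sqrt (6 * q / N%:R) < `|saa_obj xi F w x - f x|)%R])
    <= (2 * expR (- q))%:E)%E.
Proof.
move=> ss0 q0 iF Fv; have NR0 : 0 < N%:R :> R by rewrite ltr0n.
have ss2 : 0 < ss ^+ 2 by rewrite exprn_gt0.
pose r := Num.sqrt (6 * q / N%:R).
have r2 : r ^+ 2 = 6 * q / N%:R by rewrite sqr_sqrtr// divr_ge0 ?mulr_ge0.
have mc := (centered_integrable iF).
have mX : measurable_fun setT (fun z => F x z - f x).
  by apply/measurable_EFinP; case/integrableP : mc.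
pose W := 2 * ss ^+ 2 * N%:R.
have V0 : 0 < W + 2 * N%:R * ss ^+ 2 by rewrite addr_gt0// !mulr_gt0.
have u0 : 0 <= N%:R * (ss * r) by rewrite !mulr_ge0 ?sqrtr_ge0// ltW.
have tail := self_normalized_tail_abs u0 V0 mc (centered_integral0 iF) Fv.
apply: (@le_trans _ _ (2 * expR (- (3 * (N%:R * (ss * r)) ^+ 2 / (2 * (W + 2 * N%:R * ss ^+ 2)))))%:E); last first.
  rewrite lee_fin ler_wpM2l// ler_expR lerN2 !exprMn r2.
  (* Empirical and true variance contribute [2 * N * ss ^+ 2] each, so the constant 6 under the root
     gives the exponent [9 / 4 * q], more than the [q] required. *)
  rewrite (_ : _ / _ = 9 / 4 * q); first lra.
  by rewrite /W; field; rewrite !gt_eqF.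
apply: le_trans tail; apply: le_measure; rewrite ?inE.
- apply: measurableI; first by apply: measurable_emp_mean_le; exact: measurable_funX.
  apply: measurable_lt => //; apply: measurableT_comp => //.
  by apply: measurable_funB => //; exact: measurable_saa.
- apply: measurableI.
    apply: measurable_lt => //; apply: measurableT_comp => //.
    by apply: measurable_sum => k; apply: (measurableT_comp mX); exact: measurable_funP.
  apply: measurable_le => //; apply: measurable_sum => k; apply: measurable_funX.
  by apply: (measurableT_comp mX); exact: measurable_funP.
move=> w /= [Gw dev]; split; last by move: Gw; rewrite /emp_mean ler_pdivrMr.
by rewrite centered_sum normrM ger0_norm ?(ltW NR0)// ltr_pM2l.
Qed.

(* [|L0| <= (L0^2 / sigma + sigma) / 2] bounds the first moment of [L0] by [sigma]. *)
Lemma mean_obj_lipschitz (L0 : Xi -> R) (x y : 'rV[R]_d) (sigma r : R) :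
  0 < sigma -> 0 <= r ->
  PX.-integrable setT (EFin \o F x) -> PX.-integrable setT (EFin \o F y) ->
  measurable_fun setT (fun z => L0 z ^+ 2) ->
  (\int[PX]_z (L0 z ^+ 2)%:E <= (sigma ^+ 2)%:E)%E ->
  (forall z, `|F x z - F y z| <= L0 z * r) ->
  `|f x - f y| <= sigma * r.
Proof.
move=> sigma0 r0 iFx iFy mL2 L2 lip.
have mFx : measurable_fun setT (F x) by apply/measurable_EFinP; case/integrableP : iFx.
have mFy : measurable_fun setT (F y) by apply/measurable_EFinP; case/integrableP : iFy.
have iD : PX.-integrable setT (EFin \o (fun z => F x z - F y z)).
  rewrite (_ : EFin \o _ = (EFin \o F x) \- (EFin \o F y))%E; last exact/funext.
  exact: integrableB.
have mL2E : measurable_fun setT (fun z => (L0 z ^+ 2)%:E) by exact/measurable_EFinP.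
have -> : f x - f y = \int[PX]_z (F x z - F y z) by rewrite RintegralB.
apply: le_trans (le_normr_Rintegral _ iD) _ => //.
rewrite -lee_fin /Rintegral fineK; last first.
  by apply: integrable_fin_num => //; exact: integrable_abse iD.
apply: (@le_trans _ _ (\int[PX]_z ((r / (2 * sigma))%:E * (L0 z ^+ 2)%:E + (r * sigma / 2)%:E))%E).
  apply: ge0_le_integral => //.
  - apply/measurable_EFinP; apply: measurableT_comp => //; exact: measurable_funB.
  - by apply: emeasurable_funD => //; exact: measurable_funeM.
  move=> z _; rewrite -EFinM -EFinD lee_fin (le_trans (lip z))//.
  have -> : r / (2 * sigma) * L0 z ^+ 2 + r * sigma / 2 =
      L0 z * r + r / (2 * sigma) * (L0 z - sigma) ^+ 2 by field; rewrite gt_eqF.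
  by rewrite lerDl mulr_ge0 ?sqr_ge0// divr_ge0// mulr_ge0// ltW.
have c0 : (0 <= (r / (2 * sigma))%:E)%E by rewrite lee_fin divr_ge0// mulr_ge0// ltW.
rewrite ge0_integralD//=; last 3 first.
- by move=> z _; rewrite -EFinM lee_fin mulr_ge0 ?sqr_ge0.
- exact: measurable_funeM.
- by move=> z _; rewrite lee_fin divr_ge0// mulr_ge0// ltW.
rewrite integral_cst//= probability_setT mule1 ge0_integralZl//; last first.
  by move=> z _; rewrite lee_fin sqr_ge0.
apply: le_trans (leeD (lee_wpmul2l c0 L2) (lexx _)) _.
rewrite -EFinM -EFinD lee_fin le_eqVlt; apply/orP; left; apply/eqP.
by field; rewrite gt_eqF.
Qed.

(** The square of the centred increment is at most [2 * r ^+ 2 * (L0 ^+ 2 + sigma ^+ 2)]. Its mean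
    is therefore at most [v], with factor 4, and on the event its empirical sum is at most [W], with
    factor 6; [2 * (6 + 2 * 4)] is the 28 of the exponent. *)
Lemma increment_deviation (L0 : Xi -> R) (x y : 'rV[R]_d) (sigma r tau : R) :
  0 < sigma -> 0 <= r -> 0 <= tau ->
  PX.-integrable setT (EFin \o F x) -> PX.-integrable setT (EFin \o F y) ->
  measurable_fun setT (fun z => L0 z ^+ 2) ->
  (\int[PX]_z (L0 z ^+ 2)%:E <= (sigma ^+ 2)%:E)%E ->
  (forall z, `|F x z - F y z| <= L0 z * r) ->
  (PO ([set w | (emp_mean xi (fun z => L0 z ^+ 2) w <= 2 * sigma ^+ 2)%R] `&`
       [set w | (tau * (sigma / Num.sqrt N%:R) * r <
         `|(saa_obj xi F w x - f x) - (saa_obj xi F w y - f y)|)%R])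
    <= (2 * expR (- (3 * tau ^+ 2 / 28)))%:E)%E.
Proof.
move=> sigma0 r0 tau0 iFx iFy mL2 L2 lip.
have NR0 : 0 < N%:R :> R by rewrite ltr0n.
have sN0 : 0 < Num.sqrt N%:R :> R by rewrite sqrtr_gt0.
have sN2 : Num.sqrt N%:R ^+ 2 = N%:R :> R by rewrite sqr_sqrtr// ltW.
have s20 : 0 < sigma ^+ 2 by rewrite exprn_gt0.
pose X z := (F x z - f x) - (F y z - f y).
have iX : PX.-integrable setT (EFin \o X).
  rewrite (_ : EFin \o X = (EFin \o (fun z => F x z - f x)%R) \- (EFin \o (fun z => F y z - f y)%R))%E; last exact/funext.
  by apply: integrableB => //; exact: centered_integrable.
have mX : measurable_fun setT X by apply/measurable_EFinP; case/integrableP : iX.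
have X0 : (\int[PX]_z (X z)%:E = 0)%E.
  under eq_integral do rewrite EFinB.
  by rewrite integralB//; [rewrite !centered_integral0// sube0|exact: centered_integrable..].
have mL2E : measurable_fun setT (fun z => (L0 z ^+ 2)%:E) by exact/measurable_EFinP.
have fxy := mean_obj_lipschitz sigma0 r0 iFx iFy mL2 L2 lip.
have XL z : X z ^+ 2 <= 2 * r ^+ 2 * (L0 z ^+ 2 + sigma ^+ 2).
  have XE : X z = (F x z - F y z) - (f x - f y) by rewrite /X; ring.
  have : `|X z| <= (L0 z + sigma) * r.
    by rewrite XE mulrDl (le_trans (ler_normB _ _))// lerD.
  move=> h; rewrite -real_normK ?num_real//.
  apply: (@le_trans _ _ (((L0 z + sigma) * r) ^+ 2)).
    by rewrite lerXn2r ?nnegrE// (le_trans _ h).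
  have -> : 2 * r ^+ 2 * (L0 z ^+ 2 + sigma ^+ 2) =
      ((L0 z + sigma) * r) ^+ 2 + ((L0 z - sigma) * r) ^+ 2 by ring.
  by rewrite lerDl sqr_ge0.
have dev w : N%:R * ((saa_obj xi F w x - f x) - (saa_obj xi F w y - f y)) =
    \sum_k X (xi k w).
  by rewrite mulrBr -!centered_sum -sumrB.
(* For [r = 0] the variance proxy is 0 and the tail bound does not apply, but all increments
   vanish. *)
have [r_eq0|r_neq0] := eqVneq r 0.
  rewrite [X in PO X](_ : _ = set0) ?measure0 ?lee_fin ?mulr_ge0 ?expR_ge0//.
  apply/seteqP; split=> w //= [_]; rewrite r_eq0 mulr0 normr_gt0 => /eqP; apply.
  have X_eq0 : \sum_k X (xi k w) = 0.
    rewrite big1// => k _; apply/eqP.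
    have := XL (xi k w); rewrite r_eq0 expr0n/= mulr0 mul0r => h.
    by rewrite -sqrf_eq0 eq_le h sqr_ge0.
  by move: (dev w); rewrite X_eq0 => /eqP; rewrite mulf_eq0 (gt_eqF NR0)/= => /eqP.
have r_gt0 : 0 < r by rewrite lt_neqAle eq_sym r_neq0.
pose v := 4 * sigma ^+ 2 * r ^+ 2; pose W := 6 * N%:R * sigma ^+ 2 * r ^+ 2.
have Xv : (\int[PX]_z (X z ^+ 2)%:E <= v%:E)%E.
  have c0 : (0 <= (2 * r ^+ 2)%:E)%E by rewrite lee_fin mulr_ge0 ?sqr_ge0.
  apply: (@le_trans _ _ (\int[PX]_z ((2 * r ^+ 2)%:E * ((L0 z ^+ 2)%:E + (sigma ^+ 2)%:E)))%E).
    apply: ge0_le_integral => //.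
    - by move=> z _; rewrite lee_fin sqr_ge0.
    - by apply/measurable_EFinP; exact: measurable_funX.
    - by apply: measurable_funeM; exact: emeasurable_funD.
    by move=> z _; rewrite -EFinD -EFinM lee_fin.
  rewrite ge0_integralZl//; last 2 first.
  - exact: emeasurable_funD.
  - by move=> z _; rewrite -EFinD lee_fin addr_ge0 ?sqr_ge0.
  rewrite ge0_integralD//=; last 2 first.
  - by move=> z _; rewrite lee_fin sqr_ge0.
  - by move=> z _; rewrite lee_fin sqr_ge0.
  rewrite integral_cst//= probability_setT mule1.
  apply: le_trans (lee_wpmul2l c0 (leeD L2 (lexx _))) _.
  rewrite -EFinD -EFinM lee_fin /v le_eqVlt; apply/orP; left; apply/eqP; ring.
have V0 : 0 < W + 2 * N%:R * v.
  by rewrite addr_gt0// !mulr_gt0 ?exprn_gt0.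
have u0 : 0 <= N%:R * (tau * (sigma / Num.sqrt N%:R) * r).
  by rewrite !mulr_ge0 ?invr_ge0 ?(ltW sN0) ?(ltW sigma0)// ltW.
have := self_normalized_tail_abs u0 V0 iX X0 Xv.
rewrite (_ : 3 * (N%:R * (tau * (sigma / Num.sqrt N%:R) * r)) ^+ 2 / (2 * (W + 2 * N%:R * v)) =
    3 * tau ^+ 2 / 28); last first.
  rewrite !exprMn exprVn sN2 /W /v; field.
  by rewrite ?gt_eqF.
apply: le_trans; apply: le_measure; rewrite ?inE.
- apply: measurableI; first exact: measurable_emp_mean_le.
  apply: measurable_lt => //; apply: measurableT_comp => //.
  by apply: measurable_funB; apply: measurable_funB => //; exact: measurable_saa.
- apply: measurableI.
    apply: measurable_lt => //; apply: measurableT_comp => //.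
    by apply: measurable_sum => k; apply: (measurableT_comp mX); exact: measurable_funP.
  apply: measurable_le => //; apply: measurable_sum => k; apply: measurable_funX.
  by apply: (measurableT_comp mX); exact: measurable_funP.
move=> w /= [Gw devw]; split.
  by rewrite -dev normrM ger0_norm ?(ltW NR0)// ltr_pM2l.
apply: (@le_trans _ _ (\sum_k 2 * r ^+ 2 * (L0 (xi k w) ^+ 2 + sigma ^+ 2))).
  by apply: ler_sum => k _; exact: XL.
rewrite -mulr_sumr big_split/= sumr_const card_ord.
move: Gw; rewrite /emp_mean ler_pdivrMr// => Gw.
rewrite (_ : W = 2 * r ^+ 2 * (2 * sigma ^+ 2 * N%:R + sigma ^+ 2 *+ N)); last first.
  by rewrite /W -[_ *+ N]mulr_natl; ring.
by rewrite ler_wpM2l ?mulr_ge0 ?sqr_ge0// lerD2r.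
Qed.

End sample_deviations.

(** * Localization by convexity *)

Section localization.
Context (R : realType) (d : nat).
Implicit Types (Y : set 'rV[R]_d) (g : 'rV[R]_d -> R).

Lemma convex_setP Y x y s : convex_set Y -> Y x -> Y y -> 0 <= s -> s <= 1 ->
  Y (s *: x + (1 - s) *: y).
Proof.
move=> cY Yx Yy s0 s1; have := cY x y (Itv01 s0 s1) (mem_set Yx) (mem_set Yy).
by rewrite inE.
Qed.

Lemma convex_functionP Y g x y s : convex_function Y g -> Y x -> Y y ->
  0 <= s -> s <= 1 -> g (s *: x + (1 - s) *: y) <= s * g x + (1 - s) * g y.
Proof.
move=> cg Yx Yy s0 s1; exact: (cg (Itv01 s0 s1) x y (mem_set Yx) (mem_set Yy)).
Qed.

Lemma convex_functionI Y g :
  (forall x y s, Y x -> Y y -> 0 <= s -> s <= 1 ->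
    g (s *: x + (1 - s) *: y) <= s * g x + (1 - s) * g y) ->
  convex_function Y g.
Proof.
move=> cg t x y; rewrite !inE => Yx Yy; apply: (cg x y t%:num Yx Yy) => //.
Qed.

Lemma segment_IVT Y g x y c : convex_set Y -> {within Y, continuous g} ->
  Y x -> Y y -> g y <= c -> c <= g x ->
  exists s, [/\ 0 <= s, s <= 1 & g (s *: x + (1 - s) *: y) = c].
Proof.
move=> cY gc Yx Yy gy gx; pose p (s : R) : 'rV[R]_d := s *: x + (1 - s) *: y.
have pc : continuous p.
  move=> s; apply: cvgD; first by apply: cvgZr_tmp; exact: cvg_id.
  apply: cvgZr_tmp; apply: cvgB; [exact: cvg_cst|exact: cvg_id].
have p0 : p 0 = y by rewrite /p scale0r add0r subr0 scale1r.
have p1 : p 1 = x by rewrite /p scale1r subrr scale0r addr0.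
have gpc : {within `[0, 1]%classic, continuous (g \o p)}.
  apply/subspace_continuousP => s; rewrite /= in_itv/= => /andP[s0 s1].
  have Yp : Y (p s) by exact: convex_setP.
  have /subspace_continuousP/(_ _ Yp) gps := gc.
  move=> U /gps nU; have := pc s _ nU; rewrite /= !nbhs_simpl/=.
  apply: filterS => s' Ys' s'01; move: (s'01); rewrite /= in_itv/= => /andP[s'0 s'1].
  by apply: Ys'; exact: convex_setP.
have [|s] := @IVT _ (g \o p) 0 1 c ler01 gpc.
  by rewrite /= p0 p1 ge_min gy le_max gx orbT.
by rewrite in_itv/= => /andP[s0 s1] gs; exists s.
Qed.

Lemma localization Y (f G : 'rV[R]_d -> R) xs xh e0 eps beta :
  convex_set Y -> {within Y, continuous f} -> convex_function Y G ->
  minimizer Y f xs -> minimizer Y G xh -> 0 <= e0 -> 0 < eps ->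
  (forall x, Y x -> f x <= f xs + eps -> `|(G x - f x) - (G xs - f xs)| <= beta) ->
  e0 + beta < eps ->
  (forall x, Y x -> G x <= G xh + e0 -> f x <= f xs + eps) /\
  `|G xh - f xs| <= `|G xs - f xs| + beta.
Proof.
move=> cY fc cG [Ys fs] [Yh Gh] e00 eps0 dev small.
have loc x : Y x -> G x <= G xh + e0 -> f x <= f xs + eps.
  move=> Yx Gx; rewrite leNgt; apply/negP => fx.
  have [||s [s0 s1 fsE]] := segment_IVT (c := f xs + eps) cY fc Yx Ys.
  - by rewrite lerDl ltW.
  - exact: ltW.
  have Yp := convex_setP cY Yx Ys s0 s1.
  have Gp := convex_functionP cG Yx Ys s0 s1.
  (* Convexity and minimality of [xh] give [G] at most [G xs + e0] at the crossing point, while [f]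
     is exactly [f xs + eps] there. The relative deviation is thus at most [e0 - eps], which is
     below [- beta]. *)
  have := dev _ Yp; rewrite fsE => /(_ (lexx _)); rewrite ler_norml => /andP[+ _].
  have := ler_wpM2l s0 Gx; have := ler_wpM2l s0 (Gh _ Ys).
  have : s * e0 <= e0 by rewrite ler_piMl.
  nra.
(* The minimizer [xh] itself is now known to lie in the level set, so [dev] applies to it and gives
   the lower estimate; the upper one is [G xh <= G xs]. *)
split=> //; have fh : f xh <= f xs + eps by apply: loc => //; rewrite lerDl.
have := dev _ Yh fh; have := Gh _ Ys; have := fs _ Yh.
rewrite !ler_norml => h1 h2 /andP[h3 h4]; apply/andP; split.
  have := ler_norm (- (G xs - f xs)); rewrite normrN; lra.
have := ler_norm (G xs - f xs); have : 0 <= beta by lra.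
lra.
Qed.

Lemma convex_saa (T Omega : Type) (N : nat) (xi : 'I_N -> Omega -> T) Y
    (F : 'rV[R]_d -> T -> R) w :
  (forall z, convex_function Y (F ^~ z)) ->
  convex_function Y (fun x => emp_mean xi (F x) w).
Proof.
move=> cF; apply: convex_functionI => x y s Yx Yy s0 s1.
rewrite /emp_mean !mulrA -mulrDl ler_wpM2r ?invr_ge0// !mulr_sumr -big_split/=.
by apply: ler_sum => k _; exact: (convex_functionP (cF (xi k w))).
Qed.

Lemma continuous_saa (T Omega : Type) (N : nat) (xi : 'I_N -> Omega -> T) Y
    (F : 'rV[R]_d -> T -> R) w :
  (forall z, {within Y, continuous (F ^~ z)}) ->
  {within Y, continuous (fun x => emp_mean xi (F x) w)}.
Proof.
move=> cF; apply/subspace_continuousP => x Yx; rewrite /emp_mean.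
apply: cvgMl; apply: cvg_big => [|k _]; first exact: add_continuous.
by have /subspace_continuousP/(_ _ Yx) := cF (xi k w).
Qed.

End localization.

(** * Deviations over the near-optimal sets *)

Section chaining_over_level_sets.
Context (R : realType) (dX dO : measure_display).
Context (Xi : measurableType dX) (Omega : measurableType dO).
Variables (PX : probability Xi R) (PO : probability Omega R).
Variables (N : nat) (xi : 'I_N -> {RV PO >-> Xi}).
Hypotheses (N0 : (0 < N)%N) (iid : iid_sample PX xi).
Variables (d : nat) (nrm : 'rV[R]_d -> R) (F : 'rV[R]_d -> Xi -> R).
Hypothesis nrmP : is_norm nrm.
Let f := mean_obj PX F.

Lemma gamma2_ge0 (alpha : R) (M : set 'rV[R]_d) : (0 <= gamma2 nrm alpha M)%E.
Proof.
apply: le_ereal_inf_tmp => _ [A _ <-]; apply: nneseries_ge0 => j _ _.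
by rewrite mule_ge0 ?lee_fin ?powR_ge0// poweR_ge0.
Qed.

(** A second point makes the diameter positive, so the ratio is a genuine quotient and bounds
    [gamma2]. The infimum defining [gamma2] may not be attained: [eta] is the slack that selects a
    partition sequence. *)
Lemma chaining_ratio_net (alpha Ca Dm eta : R) (M : set 'rV[R]_d) (x0 x1 : 'rV[R]_d) :
  0 < alpha -> M x0 -> M x1 -> x1 <> x0 -> diam nrm M = Dm%:E ->
  0 <= Ca -> (chaining_ratio nrm alpha M ^+ 2 <= Ca%:E)%E -> 0 < eta ->
  exists u delta, let S := (Num.sqrt Ca + eta) * Dm `^ alpha in
   [/\ forall j i, M (u j i),
    forall j x, M x -> exists i, (i < 2 ^ (2 ^ j))%N /\ nrm (x - u j i) <= delta j,
    forall n, \sum_(j < n) 2 `^ (j%:R / 2) * delta j `^ alpha <= S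
    & Dm `^ alpha <= S].
Proof.
move=> alpha0 Mx0 Mx1 x10 MD Ca0 ratio eta0.
have Dm0 : 0 < Dm.
  have := nrm_le_diam nrm Mx1 Mx0; rewrite MD lee_fin; apply: lt_le_trans.
  rewrite lt_neqAle is_norm_ge0// andbT; apply/negP => /eqP/esym n0.
  by have [nz _ _] := nrmP; apply: x10; apply/eqP; rewrite -subr_eq0; apply/eqP/nz.
have Da0 : 0 < Dm `^ alpha by exact: powR_gt0.
have notsingle : ~ exists x, M = [set x].
  by move=> [x Mx]; apply: x10; move: Mx0 Mx1; rewrite Mx => -> ->.
move: ratio; rewrite /chaining_ratio asboolF// MD poweR_EFin.
have := gamma2_ge0 alpha M; case E : (gamma2 nrm alpha M) => [g||]//; last first.
  by move=> _; rewrite inver (gt_eqF Da0) gt0_mulye ?lte_fin ?invr_gt0.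
rewrite lee_fin => g0; rewrite inver (gt_eqF Da0) -EFinM -EFin_expe lee_fin => gCa.
have gS : g < (Num.sqrt Ca + eta) * Dm `^ alpha.
  rewrite -ltr_pdivrMr//; apply: (@le_lt_trans _ _ (Num.sqrt Ca)); last by rewrite ltrDl.
  rewrite -(@ler_pXn2r _ 2) ?nnegrE ?sqrtr_ge0 ?divr_ge0 ?(ltW Da0)//.
  by rewrite sqr_sqrtr.
have /ereal_inf_lt[_ [A admA <-] AS] : (gamma2 nrm alpha M < ((Num.sqrt Ca + eta) * Dm `^ alpha)%:E)%E.
  by rewrite E lte_fin.
have [u [delta [uM net sumS delta0]]] := admissible_net nrmP alpha0 Mx0 admA (ltW AS).
exists u, delta; split=> //.
have Ddelta : Dm <= delta 0%N.
  rewrite -lee_fin -MD; apply: ge_ereal_sup => _ [x Mx [y My <-]].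
  by rewrite lee_fin delta0.
apply: le_trans (sumS 1%N); rewrite big_ord1/= mul0r powRr0 mul1r.
by rewrite ge0_ler_powR ?nnegrE ?(ltW alpha0)// ltW// (lt_le_trans Dm0).
Qed.

Variables (alpha sigma t : R) (L0 : Xi -> R) (Z : set 'rV[R]_d).
Hypotheses (alpha0 : 0 < alpha) (alpha1 : alpha <= 1).
Hypotheses (sigma0 : 0 < sigma) (t0 : 0 < t).
Hypothesis iF : forall x, Z x -> PX.-integrable setT (EFin \o F x).
Hypothesis mL2 : measurable_fun setT (fun z => L0 z ^+ 2).
Hypothesis L2 : (\int[PX]_z (L0 z ^+ 2)%:E <= (sigma ^+ 2)%:E)%E.
Hypothesis hoelder : forall x x' z, Z x -> Z x' ->
  `|F x z - F x' z| <= L0 z * nrm (x - x') `^ alpha.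

(** Purely qualitative: the constant depends on the outcome and serves only to close the chains. The
    absolute value is there because [L0] may be negative. *)
Lemma deviation_hoelder w : exists2 L, 0 <= L & forall x y, Z x -> Z y ->
  `|(saa_obj xi F w x - f x) - (saa_obj xi F w y - f y)| <= L * nrm (x - y) `^ alpha.
Proof.
have NR0 : 0 < N%:R :> R by rewrite ltr0n.
exists ((\sum_k `|L0 (xi k w)|) / N%:R + sigma).
  by rewrite addr_ge0 ?(ltW sigma0)// divr_ge0// sumr_ge0.
move=> x y Zx Zy; set r := _ `^ _; have r0 : 0 <= r by exact: powR_ge0.
have fxy : `|f x - f y| <= sigma * r.
  apply: (@mean_obj_lipschitz _ _ _ _ _ _ L0) => //; [exact: iF|exact: iF|].
  by move=> z; exact: hoelder.
have -> : saa_obj xi F w x - f x - (saa_obj xi F w y - f y) =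
    (\sum_k (F x (xi k w) - F y (xi k w))) / N%:R - (f x - f y).
  by rewrite /saa_obj /emp_mean sumrB; ring.
rewrite (le_trans (ler_normB _ _))// mulrDl lerD// normrM [X in _ * X <= _]ger0_norm ?invr_ge0//.
rewrite [leRHS]mulrAC ler_wpM2r ?invr_ge0// (le_trans (ler_norm_sum _ _ _))// mulr_suml.
apply: ler_sum => k _; apply: (le_trans (hoelder _ Zx Zy)).
by rewrite ler_wpM2r// ler_norm.
Qed.

Lemma level_set_deviation (Ca Dm : R) (M : set 'rV[R]_d) (x0 : 'rV[R]_d) :
  M `<=` Z -> M x0 -> diam nrm M = Dm%:E ->
  0 <= Ca -> (chaining_ratio nrm alpha M ^+ 2 <= Ca%:E)%E ->
  exists B, [/\ measurable B, (PO B <= (expR (- t) / 4)%:E)%E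
    & forall w, emp_mean xi (fun z => L0 z ^+ 2) w <= 2 * sigma ^+ 2 -> ~ B w ->
      forall x, M x -> `|(saa_obj xi F w x - f x) - (saa_obj xi F w x0 - f x0)| <=
        100 * sigma * Dm `^ alpha * Num.sqrt ((Ca + t) / N%:R)].
Proof.
move=> MZ Mx0 MD Ca0 ratio.
(* On a single point the ratio is a mere convention, and the relative deviation is 0. *)
have [[x1 [Mx1 x10]]|single] := pselect (exists x1, M x1 /\ x1 <> x0); last first.
  exists set0; split=> //; first by rewrite measure0 lee_fin divr_ge0 ?expR_ge0.
  move=> w _ _ x Mx; have -> : x = x0.
    by apply: contrapT => xx0; apply: single; exists x.
  by rewrite subrr normr0 !mulr_ge0 ?powR_ge0 ?sqrtr_ge0// ltW.
have NR0 : 0 < N%:R :> R by rewrite ltr0n.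
have sN0 : 0 < Num.sqrt N%:R :> R by rewrite sqrtr_gt0.
have st0 : 0 < Num.sqrt t by rewrite sqrtr_gt0.
have Da0 : 0 <= Dm `^ alpha by exact: powR_ge0.
(* The slack is taken to be [Num.sqrt t], so that it merges with the term in [t] that chaining
   produces anyway. *)
have [u [delta /= [uM net sumS DmS]]] := chaining_ratio_net alpha0 Mx0 Mx1 x10 MD Ca0 ratio st0.
have s0 : 0 <= sigma / Num.sqrt N%:R by rewrite divr_ge0// ltW.
have [||||||B [mB PB BP]] := @chaining_event _ _ _ PO _ _ nrmP _ _ _ alpha0 alpha1 Mx0
  u delta _ uM net sumS (fun w x => saa_obj xi F w x - f x)
  [set w | emp_mean xi (fun z => L0 z ^+ 2) w <= 2 * sigma ^+ 2] _ t Dm s0 (ltW t0).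
- exact: measurable_emp_mean_le.
- by move=> x Mx; apply: measurable_funB => //; apply: measurable_saa; exact/iF/MZ.
- move=> w; have [L LP Lh] := deviation_hoelder w; exists L => // x y Mx My.
  by apply: Lh; exact: MZ.
- move=> x y tau Mx My tau0.
  apply: increment_deviation => //; [exact: powR_ge0|exact/iF/MZ|exact/iF/MZ|].
  by move=> z; apply: hoelder; exact: MZ.
- by move=> x y Mx My; rewrite -lee_fin -MD nrm_le_diam.
- exact: DmS.
exists B; split=> // w Gw nB x Mx; apply: le_trans (BP w Gw nB x Mx) _.
have -> : Num.sqrt ((Ca + t) / N%:R) = Num.sqrt (Ca + t) / Num.sqrt N%:R.
  by rewrite sqrtrM ?addr_ge0 ?(ltW t0)// sqrtrV// ltW.
(* Here 67 is 51 from the slack plus 16 from the start of the chain. By Cauchy-Schwarz the sharp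
   factor is the root of [51 ^ 2 + 67 ^ 2 = 7090], and 100 is a round number above it. *)
have key : 51 * Num.sqrt Ca + 67 * Num.sqrt t <= 100 * Num.sqrt (Ca + t).
  rewrite -(@ler_pXn2r _ 2) ?nnegrE ?addr_ge0 ?mulr_ge0 ?sqrtr_ge0//.
  rewrite [leRHS]exprMn sqr_sqrtr ?addr_ge0 ?(ltW t0)//.
  have aux (a b a2 b2 : R) : a ^+ 2 = a2 -> b ^+ 2 = b2 ->
      (51 * a + 67 * b) ^+ 2 <= 100 ^+ 2 * (a2 + b2).
    by move=> <- <-; have := sqr_ge0 (a - b); have := sqr_ge0 a; have := sqr_ge0 b; nra.
  by apply: aux; rewrite sqr_sqrtr// ltW.
have -> : sigma / Num.sqrt N%:R * (51 * ((Num.sqrt Ca + Num.sqrt t) * Dm `^ alpha) +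
      16 * Num.sqrt t * Dm `^ alpha) =
    sigma / Num.sqrt N%:R * Dm `^ alpha * (51 * Num.sqrt Ca + 67 * Num.sqrt t) by ring.
have -> : 100 * sigma * Dm `^ alpha * (Num.sqrt (Ca + t) / Num.sqrt N%:R) =
    sigma / Num.sqrt N%:R * Dm `^ alpha * (100 * Num.sqrt (Ca + t)) by ring.
by rewrite ler_wpM2l// mulr_ge0.
Qed.

Lemma deviation_event (Ca Dm ss rho : R) (M : set 'rV[R]_d) (x0 : 'rV[R]_d) :
  M `<=` Z -> M x0 -> diam nrm M = Dm%:E ->
  0 <= Ca -> (chaining_ratio nrm alpha M ^+ 2 <= Ca%:E)%E -> 0 < ss ->
  good_fun PX xi rho (ss ^+ 2) (fun z => (F x0 z - f x0) ^+ 2) ->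
  good_fun PX xi rho (sigma ^+ 2) (fun z => L0 z ^+ 2) ->
  exists B, [/\ measurable B, (PO B <= (expR (- t) + 2 * rho)%:E)%E
    & forall w, ~ B w ->
      `|saa_obj xi F w x0 - f x0| <= ss * Num.sqrt (6 * (1 + ln 2 + t) / N%:R) /\
      forall x, M x -> `|(saa_obj xi F w x - f x) - (saa_obj xi F w x0 - f x0)| <=
        100 * sigma * Dm `^ alpha * Num.sqrt ((Ca + t) / N%:R)].
Proof.
move=> MZ Mx0 MD Ca0 ratio ss0 [mstar _ Estar Pstar] [_ _ _ PL].
have [B0 [mB0 PB0 B0P]] := level_set_deviation MZ Mx0 MD Ca0 ratio.
pose q := 1 + ln 2 + t.
have ln2 : 0 <= ln 2 :> R by rewrite ln_ge0// ler1n.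
have q0 : 0 <= q by rewrite !addr_ge0// ltW.
have iF0 : PX.-integrable setT (EFin \o F x0) by exact/iF/MZ.
have Estar' : (\int[PX]_z ((F x0 z - f x0) ^+ 2)%:E <= (ss ^+ 2)%:E)%E.
  by move: Estar; rewrite unlock.
have cdev := center_deviation N0 iid ss0 q0 iF0 Estar'.
set Gs := [set w | _] in cdev; set Ds := [set w | _ < _] in cdev.
(* In [q] the term [ln 2] cancels the factor 2 of the two-sided tail, and the term 1 gives
   [expR (- 1) <= 1 / 2]. *)
have e2 : 2 * expR (- q) <= expR (- t) / 2.
  have -> : - q = - (1 : R) + (- ln 2 + - t) by rewrite /q; ring.
  rewrite !expRD !expRN lnK ?posrE//.
  have E1 : (expR 1)^-1 <= 2^-1 :> R.
    by rewrite lef_pV2 ?posrE ?expR_gt0// (le_trans _ (expR_ge1Dx 1))//; lra.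
  have := invr_gt0 (expR t); rewrite expR_gt0 => e0.
  have aux (a b : R) : 0 < b -> a <= 2^-1 -> 2 * (a * (2^-1 * b)) <= b / 2.
    by move=> b0 a1; nra.
  exact: aux.
have mGs : measurable Gs by exact: measurable_emp_mean_le.
have mDs : measurable Ds.
  apply: measurable_lt => //; apply: measurableT_comp => //.
  by apply: measurable_funB => //; apply: measurable_saa; exact: iF0.
have compl (h : Xi -> R) c :
    ~` [set w | emp_mean xi h w <= c] = [set w | (c < emp_mean xi h w)%R].
  by apply/seteqP; split=> w /=; rewrite ltNge => /negP.
have mGL : measurable [set w | emp_mean xi (fun z => L0 z ^+ 2) w <= 2 * sigma ^+ 2].
  exact: measurable_emp_mean_le.
exists ((~` [set w | emp_mean xi (fun z => L0 z ^+ 2) w <= 2 * sigma ^+ 2] `|` ~` Gs) `|`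
  (B0 `|` (Gs `&` Ds))); split.
- apply: measurableU; last by apply: measurableU => //; exact: measurableI.
  by apply: measurableU; exact: measurableC.
- apply: (le_trans (measureU2 _ _ _)).
  + by apply: measurableU; exact: measurableC.
  + by apply: measurableU => //; exact: measurableI.
  have -> : expR (- t) + 2 * rho = (rho + rho) + (expR (- t) / 2 + expR (- t) / 2) by field.
  rewrite EFinD; apply: leeD.
    apply: (le_trans (measureU2 _ _ _)); [exact: measurableC|exact: measurableC|].
    by rewrite EFinD; apply: leeD; rewrite compl.
  apply: (le_trans (measureU2 _ _ _)) => //; first exact: measurableI.
  rewrite EFinD; apply: leeD.
    by apply: (le_trans PB0); rewrite lee_fin ler_wpM2l ?expR_ge0//; lra.
  by apply: (le_trans cdev); rewrite lee_fin.
move=> w nB; have GL : emp_mean xi (fun z => L0 z ^+ 2) w <= 2 * sigma ^+ 2.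
  by apply: contrapT => h; apply: nB; left; left.
have Gsw : Gs w by apply: contrapT => h; apply: nB; left; right.
split; last by apply: B0P => // B0w; apply: nB; right; left.
by rewrite leNgt; apply/negP => h; apply: nB; right; right.
Qed.

End chaining_over_level_sets.

(** * The good event *)

Section good_events.
Context (R : realType) (d : nat) (dO : measure_display) (Omega : measurableType dO).
Variables (PO : probability Omega R).
Variables (Y : set 'rV[R]_d) (f : 'rV[R]_d -> R) (g : Omega -> 'rV[R]_d -> R).
Hypothesis closedY : closed Y.
Hypothesis fc : {within Y, continuous f}.
Hypothesis gc : forall w, {within Y, continuous (g w)}.
Hypothesis mg : forall x, Y x -> measurable_fun setT (g ^~ x).
Hypothesis gmin : forall w, exists x, minimizer Y (g w) x.

(** The good event with a real rate [r] and an abstract deviation [v] at the centre, so that [r] can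
    vary in a limit. *)
Definition good_at (e0 v r : R) : set Omega :=
  [set w | (forall x, Y x -> g w x <= opt_value Y (g w) + e0 -> f x <= opt_value Y f + r) /\
    `|opt_value Y (g w) - opt_value Y f| <= v + 3 / 2 * r].

Lemma measurable_good_at (e0 v r : R) : measurable (good_at e0 v r).
Proof.
apply: measurableI; first exact: measurable_near_opt_sub.
apply: measurable_le => //; apply: measurableT_comp => //.
by apply: measurable_funB => //; exact: measurable_opt_value.
Qed.

Lemma good_at_homo (e0 v r r' : R) : r <= r' -> good_at e0 v r `<=` good_at e0 v r'.
Proof.
move=> rr w [incl val]; split; last by rewrite (le_trans val)// lerD2l ler_wpM2l//.
by move=> x Yx gx; rewrite (le_trans (incl x Yx gx))// lerD2l.
Qed.

(* The deviation event depends on the level [eps > 0], so the case [r = 0] is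
   only reached as a decreasing limit of events. *)
Lemma good_at_limit (e0 v r r1 p : R) : r <= r1 -> 0 <= r -> 0 < r1 ->
  (forall eps, r <= eps -> 0 < eps -> eps <= r1 -> (p%:E <= PO (good_at e0 v eps))%E) ->
  (p%:E <= PO (good_at e0 v r))%E.
Proof.
move=> rr1 r0 r10 lb.
(* Capping at [r1] keeps the levels in the range where the lower bound is available, including when
   [r = r1]. *)
pose eps (n : nat) : R := Num.min r1 (r + n.+1%:R^-1).
have eps_lb n : r <= eps n by rewrite le_min rr1 lerDl invr_ge0 ler0n.
have eps_gt0 n : 0 < eps n by rewrite lt_min r10 ltr_wpDl// invr_gt0 ltr0n.
have eps_ub n : eps n <= r1 by rewrite ge_min lexx.
have eps_ni m n : (m <= n)%N -> eps n <= eps m.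
  move=> mn; rewrite le_min eps_ub/= ge_min lerD2l lef_pV2 ?posrE ?ltr0n//.
  by rewrite ler_nat ltnS mn orbT.
have eps_lim (a b : R) : (forall n, a <= b + 3 / 2 * eps n) -> a <= b + 3 / 2 * r.
  move=> h; apply/ler_addgt0Pr => e e0'.
  apply: (le_trans (h (Num.truncn (2 / e)))).
  have aux (E x y : R) : x <= y / 2 -> E <= r + x -> 0 < y ->
    b + 3 / 2 * E <= b + 3 / 2 * r + y by lra.
  apply: (aux _ (Num.truncn (2 / e)).+1%:R^-1) => //; last by rewrite ge_min lexx orbT.
  rewrite -[leRHS]invrK invf_div lef_pV2 ?posrE ?divr_gt0 ?ltr0n//.
  by rewrite ltW// truncnS_gt.
have -> : good_at e0 v r = \bigcap_n good_at e0 v (eps n).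
  apply/seteqP; split=> w /= => [gw n _|gw]; first exact: good_at_homo gw.
  split; last by apply: eps_lim => n; have [] := gw n I.
  move=> x Yx gx; have h n : f x <= opt_value Y f + eps n by have [+ _] := gw n I; exact.
  have [//|] := leP (f x) (opt_value Y f + r).
  (* Scaling by [3 / 2] puts the inclusion in the form of [eps_lim], with [b = 0]. *)
  move=> lt; have : 3 / 2 * (f x - opt_value Y f) <= 0 + 3 / 2 * r.
    by apply: eps_lim => n; have := h n; lra.
  lra.
have mE n : measurable (good_at e0 v (eps n)) by exact: measurable_good_at.
have cvg := @nonincreasing_cvg_mu _ _ _ PO (fun n => good_at e0 v (eps n)).
have {}cvg := cvg (le_lt_trans (probability_le1 _ (mE 0%N)) (ltry _)) mE
  (bigcap_measurableType (fun n _ => mE n))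
  (fun m n mn => introT (subsetPset _ _) (good_at_homo (eps_ni _ _ mn))).
rewrite -(cvg_lim _ cvg)//; apply: lime_ge; first by apply/cvg_ex; eexists; exact: cvg.
by apply: nearW => n /=; apply: lb.
Qed.

End good_events.

Lemma good_eventE (R : realType) (dX dO : measure_display)
    (Xi : measurableType dX) (Omega : measurableType dO)
    (PX : probability Xi R) (PO : probability Omega R)
    (N : nat) (xi : 'I_N -> {RV PO >-> Xi}) (d : nat) (Y : set 'rV[R]_d)
    (F : 'rV[R]_d -> Xi -> R) (sigmas t eps0 r : R) :
  good_event PX xi Y F sigmas t eps0 r%:E =
  good_at Y (mean_obj PX F) (saa_obj xi F) eps0
    (sigmas * Num.sqrt (6 * (1 + ln 2 + t) / N%:R)) r.
Proof.
apply/seteqP; split=> w; rewrite /good_event /good_at /= -EFinM -EFinD lee_fin.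
  move=> [incl val]; split=> // x Yx gx.
  have := incl x; rewrite /near_opt/= -!EFinD !lee_fin => incl_x.
  by have [] := incl_x (conj Yx gx).
move=> [incl val]; split=> // x [Yx]; rewrite -EFinD lee_fin => gx.
by split=> //; rewrite -EFinD lee_fin; exact: incl.
Qed.

(** * The rate as a threshold on the levels, and the combination with the deviation bounds *)

(** The level condition reads [base / 2 + Q * eps ^ (k * a) / 2 <= eps], so it is enough that [base]
    and [Q * eps ^ (k * a)] are both at most [eps]. Solving the second inequality for [eps] gives
    the power in the definition of the rate. The large-sample condition is the level condition at
    [v], strengthened by a factor 2, and gives [r <= v]. *)
Lemma opt_rate_bounds (R : realType) (C e0 sigma c a k D p v : R) :
  0 < C -> 0 <= e0 -> 0 < sigma -> 0 < c -> 0 < a -> a <= 1 -> 0 < k -> k <= 1 ->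
  0 <= D -> 0 < p -> 0 < v ->
  e0 + 2 * C * sigma * (c `^ a * v `^ (k * a) + D `^ a) * p <= v / 2 ->
  exists r, [/\ opt_rate C e0 sigma c a k D%:E p%:E = r%:E, 0 <= r, r <= v
    & forall eps, r <= eps -> 0 < eps -> eps <= v ->
      e0 + 2 * C * sigma * (c `^ a * eps `^ (k * a) + D `^ a) * p <= eps].
Proof.
move=> C0 e00 sigma0 c0 a0 a1 k0 k1 D0 p0 v0 large.
have ca0 : 0 < c `^ a by exact: powR_gt0.
have Da0 : 0 <= D `^ a by exact: powR_ge0.
pose base := 2 * e0 + 4 * C * sigma * D `^ a * p.
pose Q := 4 * C * c `^ a * sigma * p.
have Q0 : 0 < Q by rewrite !mulr_gt0.
have base0 : 0 <= base by rewrite addr_ge0 ?mulr_ge0// ltW.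
have split_cond (z : R) : e0 + 2 * C * sigma * (c `^ a * z + D `^ a) * p = base / 2 + Q * z / 2.
  by rewrite /base /Q; field.
have vka0 : 0 < v `^ (k * a) by exact: powR_gt0.
have large' : base + Q * v `^ (k * a) <= v by move: large; rewrite split_cond; lra.
have base_v : base <= v by have := mulr_gt0 Q0 vka0; lra.
have Qv : Q * v `^ (k * a) <= v by lra.
have baseE : ((2 * e0)%:E + (4 * C * sigma)%:E * D%:E `^ a * p%:E)%E = base%:E.
  by rewrite poweR_EFin -!EFinM -EFinD.
have QE : ((4 * C * c `^ a * sigma)%:E * p%:E)%E = Q%:E by rewrite -EFinM.
rewrite /opt_rate baseE QE; case: eqP => [ak1|/eqP ak1].
  exists base; split=> // eps r_eps eps0 eps_v; rewrite split_cond.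
  have ka1 : k * a = 1 by rewrite mulrC.
  (* When [a * k = 1] the second inequality is [Q <= 1], free of [eps], so the large-sample
     condition at [v] settles it for every level. *)
  have Q1 : Q <= 1.
    by move: Qv; rewrite ka1 powRr1 ?(ltW v0)// -{2}[v]mul1r ler_pM2r.
  by rewrite ka1 powRr1 ?(ltW eps0)//; have := ler_wpM2r (ltW eps0) Q1; lra.
have ak_lt1 : a * k < 1 by rewrite lt_neqAle ak1 mulr_ile1 ?(ltW a0) ?(ltW k0).
have e1 : 0 < 1 - a * k by rewrite subr_gt0.
set q := 1 / (1 - a * k); have q0 : 0 < q by rewrite divr_gt0.
exists (Num.max base (Q `^ q)).
have split_pow (z : R) : 0 < z -> z `^ (1 - a * k) * z `^ (k * a) = z.
  move=> z0; rewrite -powRD; last by apply/implyP => _; rewrite gt_eqF.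
  by rewrite [k * a]mulrC subrK powRr1// ltW.
have powq (z : R) : 0 < z -> (z `^ (1 - a * k)) `^ q = z.
  by move=> z0; rewrite -powRrM /q mul1r divff ?gt_eqF// powRr1// ltW.
split.
- by rewrite poweR_EFin EFin_max.
- by rewrite le_max base0.
- rewrite ge_max base_v/= -[leRHS]powq// ge0_ler_powR ?nnegrE ?powR_ge0 ?(ltW Q0) ?(ltW q0)//.
  by rewrite -(ler_pM2r vka0) split_pow.
move=> eps; rewrite ge_max => /andP[base_eps Q_eps] eps0 eps_v; rewrite split_cond.
have Qe : Q <= eps `^ (1 - a * k).
  have -> : Q = (Q `^ q) `^ (1 - a * k).
    by rewrite -powRrM /q mul1r mulVf ?gt_eqF// powRr1// ltW.
  by rewrite ge0_ler_powR ?nnegrE ?powR_ge0 ?(ltW e1) ?(ltW eps0).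
have := ler_wpM2r (powR_ge0 eps (k * a)) Qe; rewrite split_pow//; lra.
Qed.

(** The large-sample condition contains the finiteness of both quantities: all factors are positive,
    thanks to [0 < b] and [0 < t], so an infinite one is never multiplied by 0 and would make the
    left side infinite. *)
Lemma finite_rate_data (R : realType) (Ca D : \bar R) (N : nat) (t a e0 b v K : R) :
  (0 < N)%N -> 0 < t -> (0 <= Ca)%E -> (0 <= D)%E -> 0 < a -> 0 < b -> 0 < K ->
  (e0%:E + K%:E * (b%:E + D `^ a) * phi_rate Ca N t <= v%:E)%E ->
  Ca \is a fin_num /\ D \is a fin_num.
Proof.
move=> N0 t0 Ca0 D0 a0 b0 K0.
have NR0 : 0 < N%:R^-1 :> R by rewrite invr_gt0 ltr0n.
have Da0 : (0 <= D `^ a)%E by exact: poweR_ge0.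
have pos : (0 < K%:E * (b%:E + D `^ a))%E.
  by rewrite mule_gt0 ?lte_fin// (lt_le_trans (_ : 0 < b%:E)%E) ?lte_fin// leeDl.
have [Caoo|Cafin] := eqVneq Ca +oo%E.
  by rewrite /phi_rate Caoo addye// gt0_mulye ?lte_fin// gt0_muley.
have {}Cafin : Ca \is a fin_num by rewrite ge0_fin_numE// ltey.
have [Doo|Dfin] := eqVneq D +oo%E; last first.
  by move=> _; split=> //; rewrite ge0_fin_numE// ltey.
rewrite Doo poweRyr ?gt_eqF// addey// gt0_muley ?lte_fin//.
rewrite /phi_rate -(fineK Cafin) -EFinD -EFinM /= gt0_mulye; last first.
  rewrite lte_fin sqrtr_gt0 mulr_gt0// ltr_wpDl//.
  by rewrite fine_ge0.
by rewrite addey// leye_eq.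
Qed.

Theorem proposition3 (R : realType) :
  exists C cbdg : R, 0 < C /\ 0 < cbdg /\
  forall (d : nat) (nrm : 'rV[R]_d -> R)
    (dX dO : measure_display)
    (Xi : measurableType dX) (Omega : measurableType dO)
    (PX : probability Xi R) (PO : probability Omega R)
    (N : nat) (xi : 'I_N -> {RV PO >-> Xi})
    (Y : set 'rV[R]_d) (F : 'rV[R]_d -> Xi -> R) (xstar : 'rV[R]_d)
    (c kappa vartheta sigmas sigma alpha t eps0 : R),
  let f := mean_obj PX F in
  let Xopt := fun eps : R => near_opt Y f eps%:E in
  let D := diam nrm (Xopt 0) in
  let phi := phi_rate (chaining_const nrm Y f alpha vartheta) N t in
  let RN := opt_rate C eps0 sigma c alpha kappa D phi in
  let Good := good_event PX xi Y F sigmas t eps0 RN in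
  is_norm nrm ->
  (0 < N)%N ->
  iid_sample PX xi ->
  Y !=set0 ->
  (forall x, Y x -> PX.-integrable setT (EFin \o F x)) ->
  (forall z, {within Y, continuous (F ^~ z)}) ->
  minimizer Y f xstar ->
  (forall w, exists x, minimizer Y (saa_obj xi F w) x) ->
  convex_set Y ->
  closed Y ->
  {within Y, continuous f} ->
  convex_function Y f ->
  (forall z, convex_function Y (F ^~ z)) ->
  0 < c -> 0 < kappa -> kappa <= 1 -> 0 < vartheta ->
  (forall eps : R, 0 < eps -> eps <= vartheta ->
    (diam nrm (Xopt eps) <= (c * eps `^ kappa)%:E + D)%E) ->
  0 < sigmas -> 0 < sigma -> 0 < alpha -> alpha <= 1 ->
  0 < t ->
  0 <= eps0 -> eps0 < vartheta / 2 ->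
  (eps0%:E + (2 * C * sigma)%:E
     * ((c `^ alpha * vartheta `^ (kappa * alpha))%:E + D `^ alpha) * phi
   <= (vartheta / 2)%:E)%E ->
  (forall rho : R,
     goodness_over PX xi nrm Y F xstar (sigmas ^+ 2) (sigma ^+ 2) alpha rho
       (Xopt vartheta) ->
     measurable Good /\
     ((1 - expR (- t) - 2 * rho)%:E <= PO Good)%E)
  /\
  (forall p kp : R,
     greatness_over PX nrm Y F xstar (sigmas ^+ 2) (sigma ^+ 2) alpha p kp
       (Xopt vartheta) ->
     measurable Good /\
     ((1 - expR (- t)
        - 2 * (cbdg * kp * Num.sqrt (p / N%:R)) `^ p)%:E <= PO Good)%E).
Proof.
(* The first constant comes from chaining over a level set, the second from the truncation
   argument. *)
exists 100, (2 * expR 8); split=> //; split; first by rewrite mulr_gt0// expR_gt0.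
move=> d nrm dX dO Xi Omega PX PO N xi Y F xstar c kappa vartheta sigmas sigma alpha t eps0.
move=> f Xopt D phi RN Good nrmP N0 iid Y0 iF Fc xmin saa_min cY clY fc cf cF c0 k0 k1 v0 diamX.
move=> ss0 sigma0 a0 a1 t0 eps00 eps0v large.
have Ystar : Y xstar by case: xmin.
have fstar : opt_value Y f = f xstar by exact: opt_valueE.
have XoptE eps x : Xopt eps x <-> Y x /\ f x <= f xstar + eps.
  by rewrite /Xopt /near_opt/= fstar -EFinD lee_fin.
have Xstar eps : 0 <= eps -> Xopt eps xstar.
  by move=> e0; apply/XoptE; split=> //; rewrite lerDl.
have D0 : (0 <= D)%E by exact: diam_ge0 (Xstar 0 (lexx _)).
pose Ca := chaining_const nrm Y f alpha vartheta.
have Ca_ub eps : 0 <= eps -> eps <= vartheta ->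
    (chaining_ratio nrm alpha (Xopt eps) ^+ 2 <= Ca)%E.
  move=> e0 ev; apply: ereal_sup_ubound; exists eps => //=.
  by rewrite in_itv/= e0.
have Ca0 : (0 <= Ca)%E by apply: le_trans (Ca_ub 0 (lexx _) (ltW v0)); exact: sqre_ge0.
have cv0 : 0 < c `^ alpha * vartheta `^ (kappa * alpha) by rewrite mulr_gt0 ?powR_gt0.
have K0 : 0 < 2 * 100 * sigma by rewrite !mulr_gt0.
have [Cafin Dfin] := finite_rate_data N0 t0 Ca0 D0 a0 cv0 K0 large.
pose ca := fine Ca; pose D1 := fine D.
have ca0 : 0 <= ca by exact: fine_ge0.
have D10 : 0 <= D1 by exact: fine_ge0.
have NR0 : 0 < N%:R^-1 :> R by rewrite invr_gt0 ltr0n.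
pose p := Num.sqrt ((ca + t) / N%:R).
have p0 : 0 < p by rewrite sqrtr_gt0 mulr_gt0// ltr_wpDl.
have phiE : phi = p%:E by rewrite /phi /phi_rate -/Ca -(fineK Cafin).
have DE : D = D1%:E by rewrite /D1 fineK.
move: large; rewrite phiE DE poweR_EFin lee_fin => large.
have [r [RNE r0 rv cond]] := opt_rate_bounds (ltr0n _ 100) eps00 sigma0 c0 a0 a1 k0 k1 D10 p0 v0 large.
have GoodE : Good = good_at Y f (saa_obj xi F) eps0
    (sigmas * Num.sqrt (6 * (1 + ln 2 + t) / N%:R)) r.
  by rewrite /Good /RN phiE DE RNE good_eventE.
have gc w : {within Y, continuous (saa_obj xi F w)} by exact: continuous_saa.
have mg x : Y x -> measurable_fun setT (fun w => saa_obj xi F w x).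
  by move=> Yx; apply: measurable_saa; exact: iF.
have mGood : measurable Good by rewrite GoodE; exact: measurable_good_at.
(* The growth assumption on the diameters and subadditivity of the power turn [cond] into a bound
   with the actual diameter. Passing from [2 * 100] to [100] drops a positive amount, hence the
   strict inequality. *)
have level eps : r <= eps -> 0 < eps -> eps <= vartheta ->
    exists Dm, [/\ diam nrm (Xopt eps) = Dm%:E
      & eps0 + 100 * sigma * Dm `^ alpha * p < eps].
  move=> re e0 ev; have := diamX _ e0 ev; rewrite DE -EFinD => dX'.
  have d0 : (0 <= diam nrm (Xopt eps))%E by exact: diam_ge0 (Xstar _ (ltW e0)).
  have dfin : diam nrm (Xopt eps) \is a fin_num.
    by rewrite ge0_fin_numE// (le_lt_trans dX')// ltry.
  exists (fine (diam nrm (Xopt eps))); split; first by rewrite fineK.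
  set Dm := fine _; have Dm0 : 0 <= Dm by exact: fine_ge0.
  have DmD : Dm <= c * eps `^ kappa + D1 by rewrite -lee_fin fineK.
  have cek : 0 <= c * eps `^ kappa by rewrite mulr_ge0 ?powR_ge0// ltW.
  have Da : Dm `^ alpha <= c `^ alpha * eps `^ (kappa * alpha) + D1 `^ alpha.
    apply: (@le_trans _ _ ((c * eps `^ kappa + D1) `^ alpha)).
      by rewrite ge0_ler_powR ?nnegrE ?(ltW a0) ?addr_ge0.
    apply: (le_trans (powR_subadditive a0 a1 cek D10)).
    by rewrite lerD2r powRM ?powR_ge0 ?(ltW c0)// -powRrM.
  have sp : 0 < sigma * p by rewrite mulr_gt0.
  have cepos : 0 < c `^ alpha * eps `^ (kappa * alpha) by rewrite mulr_gt0 ?powR_gt0.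
  have D1a : 0 <= D1 `^ alpha by exact: powR_ge0.
  have := cond _ re e0 ev.
  move: (c `^ alpha * _) (D1 `^ alpha) (Dm `^ alpha) Da cepos D1a => A B E Da Apos B0.
  have h1 : sigma * p * E <= sigma * p * (A + B) by rewrite ler_wpM2l// ltW.
  have h2 : 0 < sigma * p * (A + B) by rewrite mulr_gt0// ltr_wpDr.
  have -> : 2 * 100 * sigma * (A + B) * p = 200 * (sigma * p * (A + B)) by ring.
  have -> : 100 * sigma * E * p = 100 * (sigma * p * E) by ring.
  lra.
have main rho : goodness_over PX xi nrm Y F xstar (sigmas ^+ 2) (sigma ^+ 2) alpha rho (Xopt vartheta) ->
    ((1 - expR (- t) - 2 * rho)%:E <= PO Good)%E.
  move=> [rho0 [_ [ZY Zstar] _ star [L0 [goodL hoelder]]]].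
  (* From here a positive level [eps] replaces [r]. The exceptional event [B] depends on this level,
     but the bound on its probability does not. *)
  rewrite GoodE; apply: (good_at_limit clY fc gc mg saa_min rv r0 v0) => eps re e0 ev.
  have [Dm [MD small]] := level _ re e0 ev.
  have MZ : Xopt eps `<=` Xopt vartheta.
    by move=> x /XoptE[Yx fx]; apply/XoptE; split=> //; rewrite (le_trans fx)// lerD2l.
  have [mL2 _ EL _] := goodL.
  have L2 : (\int[PX]_z (L0 z ^+ 2)%:E <= (sigma ^+ 2)%:E)%E by move: EL; rewrite unlock.
  have iFZ x : Xopt vartheta x -> PX.-integrable setT (EFin \o F x).
    by move=> /XoptE[Yx _]; exact: iF.
  have ratio : (chaining_ratio nrm alpha (Xopt eps) ^+ 2 <= ca%:E)%E.
    by rewrite fineK//; exact: Ca_ub (ltW e0) ev.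
  have [B [mB PB BP]] := deviation_event N0 iid nrmP a0 a1 sigma0 t0 iFZ mL2 L2 hoelder
    MZ (Xstar _ (ltW e0)) MD ca0 ratio ss0 star goodL.
  apply: (@le_trans _ _ (PO (~` B))).
    rewrite probability_setC// -(fineK (fin_num_measure PO _ mB)) -EFinB lee_fin.
    have : fine (PO B) <= expR (- t) + 2 * rho by rewrite -lee_fin fineK// fin_num_measure.
    lra.
  apply: le_measure; rewrite ?inE//; first exact: measurableC.
    exact: measurable_good_at.
  move=> w /= nB; have [dev0 dev] := BP w nB; have [xh xhmin] := saa_min w.
  have cG : convex_function Y (saa_obj xi F w) by exact: convex_saa.
  have [] := localization cY fc cG xmin xhmin eps00 e0 _ small.
    by move=> x Yx fx; apply: dev; apply/XoptE.
  move=> incl val; split.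
    by move=> x Yx; rewrite (opt_valueE xhmin) fstar; exact: incl.
  rewrite (opt_valueE xhmin) fstar (le_trans val)//; apply: lerD => //.
  by move: small; lra.
split=> [rho good|p' kp great]; split=> //; first exact: main.
have [p2 kp1 [pos ZYs cont star [L0 [greatL hoelder]]]] := great.
have great_good s2 h : 0 < s2 -> great_fun PX p' kp s2 h ->
    good_fun PX xi ((2 * expR 8 * kp * Num.sqrt (p' / N%:R)) `^ p') s2 h.
  by move=> s20; exact: great_fun_good.
apply: main; split.
  rewrite powR_gt0// !mulr_gt0 ?expR_gt0 ?sqrtr_gt0 ?mulr_gt0//.
  - exact: lt_le_trans kp1.
  - exact: lt_le_trans p2.
split=> //; first by apply: great_good => //; rewrite exprn_gt0.
by exists L0; split=> //; apply: great_good => //; rewrite exprn_gt0.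
Qed.
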